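(* Consider the affine control system $\dot x(t)=A(u(t))x(t)+Cu(t)+d$ in $\mathbb{R}^n$, let $\mathcal{C}$ be a pathwise connected subset of the set $E_0$ of equilibria, and define $\Omega(\mathcal{C})=\{u\in\mathrm{int}(\Omega)\mid x_u\in\mathcal{C}\}$ (the set of $u\in\mathrm{int}(\Omega)$ having an associated equilibrium $x_u$ in $\mathcal{C}$). Assume that (i) there is $u^0\in\overline{\Omega(\mathcal{C})}$ such that $A(u^0)$ has the eigenvalue $\lambda_0=0$ and $Cu^0+d$ is not in the range of $A(u^0)$; (ii) every $u\in\Omega(\mathcal{C})$, $u\ne u^0$, satisfies $\mathrm{rank}\,A(u)=n$ and the rank condition $$\mathrm{rank}[B'(u),A(u)B'(u),\dots,A(u)^{n-1}B'(u)]=n,\qquad B'(u)=C+[B_1x_u,\dots,B_mx_u].$$ Then there is an unbounded control set $D\subset\mathbb{R}^n$ containing $\mathcal{C}$ in the interior. More precisely, for $u^k\in\Omega(\mathcal{C})$ with $u^k\to u^0$ for $k\to\infty$, the equilibria $x_{u^k}\in\mathcal{C}\subset\mathrm{int}(D)$ satisfy for $k\to\infty$ $$\|x_{u^k}\|\to\infty\quad\text{and}\quad\frac{x_{u^k}}{\|x_{u^k}\|}\to\ker A(u^0)\cap\mathbb{S}^{n-1},$$ where the latter convergence to a set means that the distance to the set tends to $0$.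
   Context: Setting. $A,B_1,\dots,B_m\in\mathbb{R}^{n\times n}$, $c_1,\dots,c_m,d\in\mathbb{R}^n$, $C=(c_1,\dots,c_m)\in\mathbb{R}^{n\times m}$, $\Omega\subset\mathbb{R}^m$, $A(u)=A+\sum_{i=1}^mu_iB_i$, and $\mathcal{U}=\{u\in L^\infty(\mathbb{R},\mathbb{R}^m)\mid u(t)\in\Omega\text{ for almost all }t\}$. The solution of $\dot x=A(u(t))x+Cu(t)+d$ with $\varphi(0,x,u)=x$ is $\varphi(t,x,u)$, $t\in\mathbb{R}$. $\mathbb{S}^{n-1}$ is the Euclidean unit sphere. For $u\in\Omega$ an equilibrium for the control value $u$ is a point $x_u\in\mathbb{R}^n$ with $0=A(u)x_u+Cu+d$ (unique if $A(u)$ is invertible); $E_0=\{x\in\mathbb{R}^n\mid 0=A(u)x+Cu+d\text{ for some }u\in\mathrm{int}(\Omega)\}$. $\mathcal{O}^+(x)=\{\varphi(t,x,u)\mid t\ge0,u\in\mathcal{U}\}$. A nonvoid set $D\subset\mathbb{R}^n$ is a control set if (i) for all $x\in D$ there is $u\in\mathcal{U}$ with $\varphi(t,x,u)\in D$ for all $t\ge0$; (ii) for all $x\in D$ one has $D\subset\overline{\mathcal{O}^+(x)}$; (iii) $D$ is maximal with these properties, i.e. if $D'\supset D$ satisfies (i) and (ii), then $D'=D$. *)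

(* Defs.v *)
From HB Require Import structures.
From mathcomp Require Import all_boot all_order all_algebra.
From mathcomp Require Import all_classical all_reals all_analysis.

Set Implicit Arguments.
Unset Strict Implicit.
Unset Printing Implicit Defensive.

Import Order.TTheory GRing.Theory Num.Theory.
Import numFieldNormedType.Exports.

Local Open Scope classical_set_scope.
Local Open Scope ring_scope.

(* The library norm of 'cV[R]_n is the maximum norm: it induces the right
   topology and the right bounded sets, but not the Euclidean sphere. *)
Definition enorm (R : realType) (n : nat) (x : 'cV[R]_n) : R :=
  Num.sqrt (\sum_(i < n) x i 0 ^+ 2).

Definition esphere (R : realType) (n : nat) : set 'cV[R]_n :=
  [set x | enorm x = 1].

(* Extended-real valued, so that the distance to the empty set is +oo. *)
Definition edist_to (R : realType) (n : nat) (S : set 'cV[R]_n)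
    (x : 'cV[R]_n) : \bar R :=
  ereal_inf [set (enorm (x - y))%:E | y in S].

Definition mxker (R : realType) (n : nat) (M : 'M[R]_n) : set 'cV[R]_n :=
  [set x | M *m x = 0].

Definition mxrange (R : realType) (n : nat) (M : 'M[R]_n) : set 'cV[R]_n :=
  [set M *m x | x in setT].

Definition pathwise_connected (T : topologicalType) (R : realType)
    (S : set T) : Prop :=
  forall x y, S x -> S y -> exists g : R -> T,
    [/\ {within `[0, 1], continuous g}, g 0 = x, g 1 = y &
        forall t, t \in `[0, 1] -> S (g t)].

Record affine_system (R : realType) (n m : nat) := AffineSystem {
  sysA : 'M[R]_n;
  sysB : 'I_m -> 'M[R]_n;
  sysC : 'M[R]_(n, m);
  sysd : 'cV[R]_n;
  sysOmega : set 'cV[R]_m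
}.

Section AffineSystem.
Context (R : realType) (n m : nat) (sys : affine_system R n m).
Let mu := @lebesgue_measure R.

Definition Au (u : 'cV[R]_m) : 'M[R]_n :=
  sysA sys + \sum_(i < m) u i 0 *: sysB sys i.

Definition rhs (u : 'cV[R]_m) (x : 'cV[R]_n) : 'cV[R]_n :=
  Au u *m x + sysC sys *m u + sysd sys.

(* Measurability is with respect to the Borel sets; every class in
   L^oo(R, R^m) has a Borel measurable representative, and trajectories
   depend on the class only. *)
Definition admissible (u : R -> 'cV[R]_m) : Prop :=
  (forall j, (fun t => u t j 0) \in Lfun mu +oo) /\
  {ae mu, forall t, sysOmega sys (u t)}.

(* [trajectory x u phi]: phi is the (Caratheodory) solution t |-> phi(t, x, u),
   t in R, characterized by the integrated form of the differential equation.
   For phi continuous and u admissible the integrands are integrable on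
   compact intervals. *)
Definition trajectory (x : 'cV[R]_n) (u : R -> 'cV[R]_m)
    (phi : R -> 'cV[R]_n) : Prop :=
  [/\ continuous phi, phi 0 = x &
      forall s t i, s <= t ->
        phi t i 0 - phi s i 0 =
        \int[mu]_(r in `[s, t]) (rhs (u r) (phi r) i 0)].

Definition orbit_pos (x : 'cV[R]_n) : set 'cV[R]_n :=
  [set y | exists t u phi,
    [/\ 0 <= t, admissible u, trajectory x u phi & phi t = y]].

Definition viable (D : set 'cV[R]_n) : Prop :=
  forall x, D x -> exists u phi,
    [/\ admissible u, trajectory x u phi & forall t, 0 <= t -> D (phi t)].

Definition approx_controllable (D : set 'cV[R]_n) : Prop :=
  forall x, D x -> D `<=` closure (orbit_pos x).

Definition control_set (D : set 'cV[R]_n) : Prop :=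
  [/\ D !=set0, viable D, approx_controllable D &
      forall D', D `<=` D' -> viable D' -> approx_controllable D' -> D' = D].

Definition equilibrium (u : 'cV[R]_m) (x : 'cV[R]_n) : Prop := 0 = rhs u x.

Definition equilibria0 : set 'cV[R]_n :=
  [set x | exists2 u, interior (sysOmega sys) u & equilibrium u x].

Definition Omega_of (C : set 'cV[R]_n) : set 'cV[R]_m :=
  [set u | interior (sysOmega sys) u /\
           exists2 x, equilibrium u x & C x].

Definition Bprime (x : 'cV[R]_n) : 'M[R]_(n, m) :=
  sysC sys + \matrix_(i < n, j < m) (sysB sys j *m x) i 0.

Definition kalman_mx (u : 'cV[R]_m) (x : 'cV[R]_n) :=
  \mxrow_(k < n) (Au u ^+ k *m Bprime x).

End AffineSystem.

(* Main.v *)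
Require Import Defs.
From HB Require Import structures.
From mathcomp Require Import all_boot all_order all_algebra.
From mathcomp Require Import all_classical all_reals all_analysis.
From mathcomp Require Import measurable_realfun ess_sup_inf ring lra.
Set Implicit Arguments.
Unset Strict Implicit.
Unset Printing Implicit Defensive.
Import Order.TTheory GRing.Theory Num.Theory.
Import numFieldNormedType.Exports.
Local Open Scope classical_set_scope.
Local Open Scope ring_scope.

(** Every control value [u] in [Omega_of sys C] differs from [u0], because an
    equilibrium for [u0] would put [C u0 + d] into the range of [A(u0)]. Hence
    the linearization at each equilibrium [x] in [C] is controllable.

    The core is local controllability at such an [x] ([locally_controllable]):
    some neighbourhood of [x] consists of points that can be steered to one
    another, by piecewise constant controls. With [G = int_0^t exp(s A) ds]
    ([expint]), the flow under a constant control is [x + G rhs(u, x)], an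
    explicit expression in [G]. In coordinates centred at the equilibrium, a
    step of length [t] with control [u + v] is [y |-> S y + G B' v] with [S =
    1 + G A = exp(t A)], up to a remainder whose Lipschitz constant is
    arbitrarily small near the origin ([cst_flow_expansion]). For small [t]
    the sampled pair [(S, G B')] inherits the rank condition from [(A, B')]
    ([exists_sampling]), so the controls of [n] consecutive steps can be
    chosen linear in one vector [b] in [R^n] in such a way that the linear
    part of the endpoint is [S^n a + b]. Solving for [b] is then a contraction
    problem ([small_solve]). The initial point [a] and the target enter as
    parameters, so forward and backward reachability are obtained at once.

    Mutual reachability is therefore an equivalence relation that is locally
    constant on [C]; connectedness of paths makes all of [C] mutually
    reachable, together with a neighbourhood of it. Let [M] be the resulting
    set. It is viable, since one can return to an equilibrium and stay there,
    and any two of its points are reachable from each other. The control set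
    [D] is the union of all viable and approximately controllable sets
    containing [C] ([control_set_of_locally_controllable]): maximality is
    immediate, and the union stays approximately controllable because an
    approximate arrival at a point of [C] can be corrected locally to an exact
    one. Concatenating arbitrary admissible controls relies on the translation
    invariance of the Lebesgue measure.

    For the asymptotics, a matrix [W] with [W A(u0) = 0] and [W (C u0 + d) <>
    0] turns the equilibrium equation into [W A(u_k) x_k = - W (C u_k + d)],
    whose right-hand side stays away from zero while [W A(u_k)] tends to zero;
    so [|x_k|] tends to infinity ([equilibria_norm_cvgy]), and [D] is
    unbounded. The images under [A(u0)] of [x_k / |x_k|] tend to zero, and a
    generalized inverse of [A(u0)] converts this into a bound for the distance
    to the unit sphere of the kernel ([normalized_equilibria_cvg]). *)

(** * Translation invariance and essentially bounded functions *)

Section Translation.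
Context (R : realType).
Local Notation mu := (@lebesgue_measure R).

Lemma measurable_shift (a : R) :
  measurable_fun [set: measurableTypeR R]
    (fun t : measurableTypeR R => t + a : measurableTypeR R).
Proof. exact: measurable_funD. Qed.

(** Both sides are measures that agree on half-open intervals, and such a
    measure is unique. *)
Lemma lebesgue_measure_shift (a : R) (A : set R) : measurable A ->
  mu ((fun t => t + a) @^-1` A) = mu A.
Proof.
move=> mA.
pose f := (fun t => t + a) : measurableTypeR R -> measurableTypeR R.
have mf : measurable_fun setT f by exact: measurable_shift.
rewrite -[LHS]/(pushforward mu f A); apply/esym.
apply: (@lebesgue_measure_unique R (pushforward mu f)) => // _ [[x y]] _ <-.
rewrite /pushforward /=.
rewrite [X in _ = mu X](_ : _ = `]x - a, y - a]%classic); last first.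
  by apply/seteqP; split => t /=; rewrite !in_itv /= /f; lra.
rewrite !lebesgue_measure_itv/= !lte_fin ltrD2r.
by case: ifP => // _; rewrite -!EFinD; congr (_%:E); ring.
Qed.

Lemma ae_shift (a : R) (P : R -> Prop) :
  {ae mu, forall t, P t} -> {ae mu, forall t, P (t + a)}.
Proof.
move=> [N [mN N0 PN]]; exists ((fun t => t + a) @^-1` N); split.
- rewrite -[X in measurable X]setTI; exact: measurable_shift.
- by rewrite lebesgue_measure_shift.
- by move=> t /= Pt; apply: PN.
Qed.

Lemma ae_imp (P Q : R -> Prop) : (forall t, P t -> Q t) ->
  {ae mu, forall t, P t} -> {ae mu, forall t, Q t}.
Proof. by move=> PQ; exact: (@filterS _ _ (ae_filter_ringOfSetsType mu)). Qed.

Lemma ae_imp2 (P Q S : R -> Prop) : (forall t, P t -> Q t -> S t) ->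
  {ae mu, forall t, P t} -> {ae mu, forall t, Q t} -> {ae mu, forall t, S t}.
Proof. by move=> PQ; exact: (@filterS2 _ _ (ae_filter_ringOfSetsType mu)). Qed.

(** The real-valued integral is a difference of the integrals of the positive
    and the negative part, so the change of variables for nonnegative functions
    gives the equality even where the integrals diverge. *)
Lemma Rintegral_shift (a s t : R) (f : R -> R) :
  measurable_fun setT f ->
  \int[mu]_(r in `[s, t]) f (r + a) = \int[mu]_(r in `[s + a, t + a]) f r.
Proof.
move=> mf; rewrite /Rintegral; congr fine.
have pre : (fun r => r + a) @^-1` `[s + a, t + a]%classic = `[s, t]%classic.
  by apply/seteqP; split => r /=; rewrite !in_itv /=; lra.
pose phi := (fun t => t + a) : measurableTypeR R -> measurableTypeR R.
have mphi : measurable_fun setT phi by exact: measurable_shift.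
have gef (g : measurableTypeR R -> \bar R) : measurable_fun setT g ->
    (forall x, 0 <= g x)%E ->
    (\int[mu]_(r in `[s, t]) g (r + a)%R =
     \int[mu]_(r in `[(s + a)%R, (t + a)%R]) g r)%E.
  move=> mg g0.
  have := @ge0_integral_pushforward _ _ _ _ R phi mphi mu
    `[s + a, t + a]%classic g (measurable_itv _) (measurable_funTS mg).
  rewrite pre /= => <- //.
  by apply: eq_measure_integral => A mA _; exact: lebesgue_measure_shift.
have mEf : measurable_fun setT (EFin \o f) by exact/measurable_EFinP.
rewrite [LHS]integralE [RHS]integralE.
congr (_ - _)%E.
- rewrite -gef; last 2 first.
  + exact: measurable_funepos.
  + by move=> x; exact: funepos_ge0.
  by apply: eq_integral => x _; rewrite !funeposE.
- rewrite -gef; last 2 first.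
  + exact: measurable_funeneg.
  + by move=> x; exact: funeneg_ge0.
  by apply: eq_integral => x _; rewrite !funenegE.
Qed.

End Translation.

Section LinftyFunctions.
Context (R : realType).
Local Notation mu := (@lebesgue_measure R).

Lemma lebesgue_measure_setT_gt0 : (0 < mu setT)%E.
Proof.
apply: (@lt_le_trans _ _ (mu `[0, 1]%classic)).
  by rewrite lebesgue_measure_itv/= lte_fin ltr01 -EFinD lte_fin subr0 ltr01.
by apply: le_measure => //; rewrite inE.
Qed.

(** This form of membership in [L^oo] is stable under translation and under
    case distinctions in time, which the essential supremum itself hides. *)
Lemma LfunooP (f : R -> R) :
  f \in Lfun mu +oo <->
  measurable_fun setT f /\ exists M, {ae mu, forall t, `|f t| <= M}.
Proof.
split.
- move=> /andP[/set_mem mf /set_mem]; rewrite /finite_norm unlock.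
  rewrite lebesgue_measure_setT_gt0 => Ns; split => //.
  have ubE (e : \bar R) : (e < +oo)%E -> exists M, (e <= M%:E)%E.
    by case: e => [r|//|_]; [exists r|exists 0; rewrite leNye].
  have [M HM] := ubE _ Ns.
  exists M; move/ess_supP: HM; apply: ae_imp => x /=.
  by rewrite lee_fin.
- move=> [mf [M HM]]; apply/andP; split.
    by rewrite inE.
  rewrite inE /= /finite_norm unlock lebesgue_measure_setT_gt0.
  apply: (@le_lt_trans _ _ M%:E); last exact: ltry.
  by apply/ess_supP; apply: ae_imp HM => x /=; rewrite lee_fin.
Qed.

End LinftyFunctions.

Section EssentiallyBounded.
Context (R : realType).
Local Notation mu := (@lebesgue_measure R).

(** Measurability is required on the whole line, so that functions can be
    translated; boundedness only on [D], so that continuous trajectories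
    qualify on compact intervals. *)
Definition ess_bounded_on (D : set R) (f : R -> R) : Prop :=
  measurable_fun setT f /\ exists M, {ae mu, forall t, D t -> `|f t| <= M}.

Lemma ess_bounded_cst D c : ess_bounded_on D (fun=> c).
Proof. by split; [exact: measurable_cst|exists `|c|; exact: aeW]. Qed.

Lemma ess_boundedD D f g : ess_bounded_on D f -> ess_bounded_on D g ->
  ess_bounded_on D (fun t => f t + g t).
Proof.
move=> [mf [M fM]] [mg [N gN]]; split; first exact: measurable_funD.
exists (M + N); apply: ae_imp2 fM gN => t ft gt Dt.
by rewrite (le_trans (ler_normD _ _))// lerD ?ft ?gt.
Qed.

Lemma ess_boundedM D f g : ess_bounded_on D f -> ess_bounded_on D g ->
  ess_bounded_on D (fun t => f t * g t).
Proof.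
move=> [mf [M fM]] [mg [N gN]]; split; first exact: measurable_funM.
exists (M * N); apply: ae_imp2 fM gN => t ft gt Dt.
by rewrite normrM ler_pM ?ft ?gt.
Qed.

Lemma ess_bounded_sum D (I : finType) (F : I -> R -> R) :
  (forall i, ess_bounded_on D (F i)) ->
  ess_bounded_on D (fun t => \sum_i F i t).
Proof.
move=> H; elim: (index_enum I) => [|i r IH].
  under eq_fun do rewrite big_nil; exact: ess_bounded_cst.
under eq_fun do rewrite big_cons; exact: ess_boundedD.
Qed.

Lemma ess_bounded_Linfty D f : f \in Lfun mu +oo -> ess_bounded_on D f.
Proof.
move=> /LfunooP[mf [M fM]]; split => //; exists M.
by apply: ae_imp fM.
Qed.

Lemma ess_bounded_continuous (s t : R) f :
  continuous f -> ess_bounded_on `[s, t] f.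
Proof.
move=> cf; split; first exact: continuous_measurable_fun.
have [M HM] : bounded_set (f @` `[s, t]).
  apply: compact_bounded; apply: continuous_compact; last first.
    exact: segment_compact.
  exact: continuous_subspaceT.
exists (`|M| + 1); apply: aeW => x Dx; apply: HM.2; last by exists x.
by rewrite ltr_pwDr// ler_norm.
Qed.

Lemma ess_bounded_integrable (s t : R) f :
  ess_bounded_on `[s, t] f -> mu.-integrable `[s, t] (EFin \o f).
Proof.
move=> [mf [M fM]].
have mEf : measurable_fun `[s, t] (EFin \o f).
  by apply/measurable_EFinP; exact: measurable_funTS.
apply/integrableP; split => //.
have mu_lt : (mu `[s, t]%classic < +oo)%E.
  by rewrite lebesgue_measure_itv; case: ifP => // _; rewrite -EFinD ltry.
apply: (@le_lt_trans _ _ ((`|M| + 1)%:E * mu `[s, t]%classic)%E).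
  apply: integral_le_bound => //.
  apply: ae_imp fM => x fx Dx; rewrite lee_fin (le_trans (fx Dx))//.
  by rewrite (le_trans (ler_norm _))// lerDl.
by rewrite lte_mul_pinfty ?lee_fin ?addr_ge0.
Qed.

End EssentiallyBounded.

(** * Trajectories: shift in time and concatenation *)

Section Trajectories.
Context (R : realType) (n m : nat) (sys : affine_system R n m).
Local Notation mu := (@lebesgue_measure R).

Lemma rhsE u x i :
  rhs sys u x i 0 =
  \sum_j (sysA sys i j + \sum_k u k 0 * sysB sys k i j) * x j 0 +
  \sum_k sysC sys i k * u k 0 + sysd sys i 0.
Proof.
rewrite /rhs !mxE; congr (_ + _ + _); apply: eq_bigr => j _.
rewrite /Au mxE summxE; congr ((_ + _) * _).
by apply: eq_bigr => k _; rewrite mxE.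
Qed.

(** The right-hand side is polynomial in essentially bounded functions, hence
    integrable on compact intervals along every trajectory. *)
Lemma ess_bounded_rhs u phi s t i : admissible sys u -> continuous phi ->
  ess_bounded_on `[s, t] (fun r => rhs sys (u r) (phi r) i 0).
Proof.
move=> [uL _] cphi.
have -> : (fun r => rhs sys (u r) (phi r) i 0) = (fun r =>
    \sum_j (sysA sys i j + \sum_k u r k 0 * sysB sys k i j) * phi r j 0 +
    \sum_k sysC sys i k * u r k 0 + sysd sys i 0).
  by apply/funext => r; exact: rhsE.
apply: ess_boundedD; last exact: ess_bounded_cst.
apply: ess_boundedD; apply: ess_bounded_sum => j.
- apply: ess_boundedM; last first.
    apply: ess_bounded_continuous => r.
    apply: (@continuous_comp _ _ _ phi (fun x : 'cV[R]_n => x j 0)).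
      exact: cphi.
    exact: coord_continuous.
  apply: ess_boundedD; first exact: ess_bounded_cst.
  apply: ess_bounded_sum => k; apply: ess_boundedM; last exact: ess_bounded_cst.
  exact: (ess_bounded_Linfty _ (uL k)).
- by apply: ess_boundedM; [exact: ess_bounded_cst
                           |exact: (ess_bounded_Linfty _ (uL j))].
Qed.

Lemma admissible_cst u : sysOmega sys u -> admissible sys (fun=> u).
Proof.
move=> Ou; split; last exact: aeW.
move=> j; apply/LfunooP; split; first exact: measurable_cst.
by exists `|u j 0|; apply: aeW.
Qed.

Lemma admissible_shift a u :
  admissible sys u -> admissible sys (fun t => u (t + a)).
Proof.
move=> [uL uO]; split; last exact: (ae_shift a uO).
move=> j; have /LfunooP[mu_ [M uM]] := uL j.
apply/LfunooP; split.
  exact: (measurableT_comp mu_ (measurable_shift a)).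
by exists M; exact: (ae_shift a uM).
Qed.

Lemma trajectory_shift a x u phi : admissible sys u -> trajectory sys x u phi ->
  trajectory sys (phi a) (fun t => u (t + a)) (fun t => phi (t + a)).
Proof.
move=> au [cphi phi0 phiE]; split => [t| |s t i st].
- apply: continuous_comp; last exact: cphi.
  by apply: continuousD; [exact: cvg_id|exact: cvg_cst].
- by rewrite add0r.
- rewrite phiE ?lerD2r//; apply/esym.
  apply: (@Rintegral_shift R a s t (fun r => rhs sys (u r) (phi r) i 0)).
  by have [] := ess_bounded_rhs 0 0 i au cphi.
Qed.

(** Switching at time 0 loses no generality, since trajectories can be shifted
    in time. *)
Definition glue (T : Type) (f g : R -> T) (t : R) : T :=
  if t < 0 then f t else g t.

Lemma admissible_glue u v : admissible sys u -> admissible sys v ->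
  admissible sys (glue u v).
Proof.
move=> [uL uO] [vL vO]; split; last first.
  by apply: ae_imp2 uO vO => t ut vt; rewrite /glue; case: ifP.
move=> j; have /LfunooP[mu_ [M uM]] := uL j.
have /LfunooP[mv [N vN]] := vL j; apply/LfunooP; split.
  rewrite (_ : (fun t => _) =
      (fun t => if t < 0 then u t j 0 else v t j 0)); last first.
    by apply/funext => t; rewrite /glue; case: ifP.
  apply: measurable_fun_ifT => //.
  by apply: measurable_fun_ltr => //; exact: measurable_cst.
exists (Num.max M N); apply: ae_imp2 uM vN => t ut vt.
by rewrite /glue le_max; case: ifP => _; rewrite ?ut ?vt ?orbT.
Qed.

(** Switching the control at a time where both trajectories agree yields a
    trajectory: the integral over an interval across 0 splits there, and the
    value of the control at 0 affects no integral. *)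
Lemma trajectory_glue x u v phi psi : admissible sys u -> admissible sys v ->
  trajectory sys x u phi -> trajectory sys x v psi ->
  trajectory sys x (glue u v) (glue phi psi).
Proof.
move=> au av [cphi phi0 phiE] [cpsi psi0 psiE].
(* This closed form makes continuity of the glued trajectory immediate. *)
have glueE t : glue phi psi t = phi (Num.min t 0) + psi (Num.max t 0) - x.
  rewrite /glue; case: ltP => t0; first by rewrite psi0 addrK.
  by rewrite phi0 addrC addKr.
have cphi_min : continuous (fun t : R => phi (Num.min t 0)).
  move=> t; apply: (@continuous_comp _ _ _ (fun t : R => Num.min t 0) phi);
    last exact: cphi.
  by apply: (@continuous_min _ _ (@id R) (cst 0));
    [exact: cvg_id|exact: cvg_cst].
have cpsi_max : continuous (fun t : R => psi (Num.max t 0)).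
  move=> t; apply: (@continuous_comp _ _ _ (fun t : R => Num.max t 0) psi);
    last exact: cpsi.
  by apply: (@continuous_max _ _ (@id R) (cst 0));
    [exact: cvg_id|exact: cvg_cst].
have cglue : continuous (glue phi psi).
  rewrite (funext glueE) => t.
  exact: (cvgB (cvgD (cphi_min t) (cpsi_max t)) (cvg_cst x)).
have ag := admissible_glue au av.
have integ s t i : mu.-integrable `[s, t]
    (EFin \o fun r => rhs sys (glue u v r) (glue phi psi r) i 0).
  exact/ess_bounded_integrable/ess_bounded_rhs.
have left s t i : s <= t -> t <= 0 ->
    \int[mu]_(r in `[s, t]) rhs sys (glue u v r) (glue phi psi r) i 0 =
    phi t i 0 - phi s i 0.
  move=> st t0; rewrite phiE//.
  rewrite -Rintegral_itv_bndo_bndc; last first.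
    by apply: integrableS (integ s t i) => //; exact: subset_itv_co_cc.
  rewrite -[RHS]Rintegral_itv_bndo_bndc; last first.
    apply: (@integrableS _ _ _ mu `[s, t]) => //.
      exact: subset_itv_co_cc.
    exact/ess_bounded_integrable/ess_bounded_rhs.
  apply: eq_Rintegral => r; rewrite inE /= in_itv /= => /andP[_ rt].
  by rewrite /glue (lt_le_trans rt t0).
have right s t i : s <= t -> 0 <= s ->
    \int[mu]_(r in `[s, t]) rhs sys (glue u v r) (glue phi psi r) i 0 =
    psi t i 0 - psi s i 0.
  move=> st s0; rewrite psiE//.
  apply: eq_Rintegral => r; rewrite inE /= in_itv /= => /andP[sr _].
  by rewrite /glue ltNge (le_trans s0 sr).
split => //; first by rewrite /glue ltxx.
move=> s t i st; rewrite !glueE !mxE.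
have [t0|t0] := leP t 0.
  rewrite left// (min_idPl (le_trans st t0)) (max_idPr (le_trans st t0)).
  by ring.
have [s0|s0] := leP 0 s.
  by rewrite right//; ring.
have st0 : \int[mu]_(r in `[s, t]) rhs sys (glue u v r) (glue phi psi r) i 0 =
    \int[mu]_(r in `[s, 0]) rhs sys (glue u v r) (glue phi psi r) i 0 +
    \int[mu]_(r in `[0, t]) rhs sys (glue u v r) (glue phi psi r) i 0.
  apply/eqP; rewrite addrC -subr_eq; apply/eqP.
  rewrite Rintegral_itvB//=; last 2 first.
    by rewrite bnd_simp ltW.
    by rewrite bnd_simp ltW.
  rewrite Rintegral_itv_obnd_cbnd//.
  by apply: integrableS (integ 0 t i) => //; exact: subset_itv_oc_cc.
rewrite st0 (left s 0 i (ltW s0) (lexx 0)) (right 0 t i (ltW t0) (lexx 0)).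
rewrite phi0 psi0; ring.
Qed.

End Trajectories.

(** * Reachability and control sets *)

Section Reachability.
Context (R : realType) (n m : nat) (sys : affine_system R n m).

(** Shift the switching time to 0, glue, and shift back. *)
Lemma trajectory_concat x t u phi v psi : 0 <= t ->
    admissible sys u -> trajectory sys x u phi ->
    admissible sys v -> trajectory sys (phi t) v psi ->
  exists w chi, [/\ admissible sys w, trajectory sys x w chi,
    forall r, r <= t -> chi r = phi r &
    forall r, t <= r -> chi r = psi (r - t)].
Proof.
move=> t0 au tu av tv.
have ag := admissible_glue (admissible_shift t au) av.
have tg := trajectory_glue (admissible_shift t au) av
  (trajectory_shift t au tu) tv.
have [_ phi0 _] := tu; have [_ psi0 _] := tv.
(* At [r = t] the second branch is selected; it starts at [phi t]. *)
have chiE r : r <= t ->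
    glue (fun t1 => phi (t1 + t)) psi (r + - t) = phi r.
  rewrite /glue le_eqVlt subr_lt0 subrK => /predU1P[->|->//].
  by rewrite ltxx subrr.
exists (fun r => glue (fun t1 => u (t1 + t)) v (r + - t)).
exists (fun r => glue (fun t1 => phi (t1 + t)) psi (r + - t)); split.
- exact: admissible_shift.
- have := trajectory_shift (- t) ag tg; congr trajectory.
  by have := chiE _ t0; rewrite add0r phi0.
- exact: chiE.
- by move=> r tr; rewrite /glue subr_lt0 ltNge tr.
Qed.

Lemma orbit_pos_trans x y z :
  orbit_pos sys x y -> orbit_pos sys y z -> orbit_pos sys x z.
Proof.
move=> [t [u [phi [t0 au tu <-]]]] [s [v [psi [s0 av tv <-]]]].
have [w [chi [aw tw _ chiE]]] := trajectory_concat t0 au tu av tv.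
exists (t + s), w, chi; split => //; first exact: addr_ge0.
by rewrite chiE ?lerDl// addrC addKr.
Qed.

Lemma trajectory_equilibrium u x :
  equilibrium sys u x -> trajectory sys x (fun=> u) (fun=> x).
Proof.
move=> ux; split => // [t|s t i st]; first exact: cvg_cst.
have -> : (fun=> rhs sys u x i 0) = (fun=> 0) :> (R -> R).
  by rewrite -[rhs sys u x]ux; apply/funext => r; rewrite mxE.
by rewrite Rintegral_cst// mul0r subrr.
Qed.

Definition mutually_reachable x : set 'cV[R]_n :=
  [set y | orbit_pos sys x y /\ orbit_pos sys y x].

(** A point of the class can be steered to the equilibrium [x], where the
    constant control keeps it.  All intermediate points are reachable from [x]
    through the initial point, so they belong to the class. *)
Lemma viable_mutually_reachable u x :
  sysOmega sys u -> equilibrium sys u x -> viable sys (mutually_reachable x).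
Proof.
move=> Ou ux z [xz [t [v [phi [t0 av tv phit]]]]].
have au := admissible_cst Ou.
have tc : trajectory sys (phi t) (fun=> u) (fun=> x).
  by rewrite phit; exact: trajectory_equilibrium.
have [w [chi [aw tw chil chir]]] := trajectory_concat t0 av tv au tc.
exists w, chi; split => // r r0.
have [rt|tr] := leP r t; last first.
  rewrite chir ?ltW//; split; exists 0, (fun=> u), (fun=> x); split => //;
    exact: trajectory_equilibrium.
rewrite chil//; split.
  by apply: orbit_pos_trans xz _; exists r, v, phi.
exists (t - r), (fun s => v (s + r)), (fun s => phi (s + r)); split.
- by rewrite subr_ge0.
- exact: admissible_shift.
- exact: trajectory_shift tv.
- by rewrite subrK.
Qed.

Lemma approx_mutually_reachable x :
  approx_controllable sys (mutually_reachable x).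
Proof.
move=> y [_ yx] z [xz _]; apply: subset_closure.
exact: orbit_pos_trans yx xz.
Qed.

Lemma mutually_reachable_trans x y z :
  mutually_reachable x y -> mutually_reachable y z -> mutually_reachable x z.
Proof.
move=> [xy yx] [yz zy]; split; first exact: orbit_pos_trans xy yz.
exact: orbit_pos_trans zy yx.
Qed.

(** The control set is the union of all viable, approximately controllable
    sets that contain [C].  Chaining two approximate controllability statements
    through [x0] is possible because every point near [x0] can be steered to
    [x0] exactly; [D0] guarantees that the union has a member. *)
Lemma control_set_of_locally_controllable (C D0 : set 'cV[R]_n)
    (x0 : 'cV[R]_n) :
    C x0 -> nbhs x0 [set z | orbit_pos sys z x0] ->
    C `<=` D0 -> viable sys D0 -> approx_controllable sys D0 ->
  exists2 D, control_set sys D & D0 `<=` D.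
Proof.
move=> Cx0 Nx0 CD0 vD0 aD0.
pose good E := [/\ C `<=` E, viable sys E & approx_controllable sys E].
have gD0 : good D0 by [].
pose D := [set x | exists2 E, good E & E x].
have subD E : good E -> E `<=` D by move=> gE x Ex; exists E.
exists D; last exact: subD.
split.
- by exists x0; apply: (subD D0) => //; exact: CD0.
- move=> x [E gE Ex]; have [_ vE _] := gE.
  have [u [phi [au tu Ephi]]] := vE x Ex.
  by exists u, phi; split => // t t0; apply: (subD E) => //; exact: Ephi.
- move=> x [E [CE _ aE] Ex] y [F [CF _ aF] Fy].
  have xx0 : orbit_pos sys x x0.
    have [z [xz zx0]] := aE x Ex x0 (CE _ Cx0) _ Nx0.
    exact: orbit_pos_trans xz zx0.
  apply: closureS (aF x0 (CF _ Cx0) y Fy) => z.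
  exact: orbit_pos_trans.
- move=> D' DD' vD' aD'; apply/seteqP; split => //.
  apply: (subD); split => //.
  exact: (subset_trans CD0 (subset_trans (subD _ gD0) DD')).
Qed.

(** Along a path in [C] the points mutually reachable with [x0] form a set that
    is relatively open and relatively closed: by the local hypothesis each point
    of the path shares its class with a whole neighbourhood. *)
Lemma path_connected_mutually_reachable (C : set 'cV[R]_n) (x0 : 'cV[R]_n) :
    pathwise_connected R C -> C x0 ->
    (forall x, C x -> nbhs x (mutually_reachable x)) ->
  forall x, C x -> mutually_reachable x0 x.
Proof.
move=> pc Cx0 loc x Cx.
have [g [cg g0 g1 Cg]] := pc x0 x Cx0 Cx.
pose S := g @` `[0, 1].
have SC : S `<=` C by move=> _ [t t01 <-]; apply: Cg.
have cS : connected S.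
  by apply: connected_continuous_connected => //; exact: segment_connected.
have Sx0 : S x0 by exists 0; rewrite //= in_itv /= lexx ler01.
have Sx : S x by exists 1; rewrite //= in_itv /= lexx ler01.
pose M := mutually_reachable x0.
suff SM : S `&` M = S by move: Sx; rewrite -SM => -[].
apply: cS.
- by exists x0; split => //; have /nbhs_singleton := loc x0 Cx0.
- exists M^°; first exact: open_interior.
  apply/seteqP; split => z [Sz Mz]; split => //; last exact: interior_subset.
  have := loc z (SC z Sz); apply: filterS => y; exact: mutually_reachable_trans.
- exists (closure M); first exact: closed_closure.
  apply/seteqP; split => z [Sz Mz]; split => //; first exact: subset_closure.
  have [y [My [zy yz]]] := Mz _ (loc z (SC z Sz)).
  exact: mutually_reachable_trans My _.
Qed.

End Reachability.

(** * Norms and limits of matrices *)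

Section MatrixNorm.
Context (R : realType).

Lemma mx_entry_le m n (A : 'M[R]_(m, n)) i j : `|A i j| <= `|A|.
Proof.
rewrite [leRHS]/Num.norm /= mx_normrE.
by apply/bigmax_geP; right; exists (i, j).
Qed.

Lemma mx_norm_leP m n (A : 'M[R]_(m, n)) c : 0 <= c ->
  (forall i j, `|A i j| <= c) -> `|A| <= c.
Proof.
move=> c0 Ac; rewrite [leLHS]/Num.norm /= mx_normrE.
by apply/bigmax_leP; split => // -[i j] _; exact: Ac.
Qed.

(** The maximum norm is submultiplicative only up to the inner dimension. *)
Lemma ler_norm_mulmx m n p (A : 'M[R]_(m, n)) (B : 'M[R]_(n, p)) :
  `|A *m B| <= n%:R * `|A| * `|B|.
Proof.
apply: mx_norm_leP => [|i j]; first by rewrite !mulr_ge0.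
rewrite mxE (le_trans (ler_norm_sum _ _ _))//.
apply: (@le_trans _ _ (\sum_(k < n) `|A| * `|B|)).
  by apply: ler_sum => k _; rewrite normrM ler_pM// mx_entry_le.
by rewrite sumr_const card_ord -[leLHS]mulr_natl mulrA.
Qed.

End MatrixNorm.

Section MatrixLimits.
Context (R : realType).

Lemma cvg_sumr (V : normedModType R) (T I : Type)
    (F : set_system T) (r : seq I) (f : I -> T -> V) (l : I -> V) :
  Filter F -> (forall i, f i x @[x --> F] --> l i) ->
  \sum_(i <- r) f i x @[x --> F] --> \sum_(i <- r) l i.
Proof.
move=> FF fl; elim: r => [|i r IH].
  by under eq_fun do rewrite big_nil; rewrite big_nil; exact: cvg_cst.
by under eq_fun do rewrite big_cons; rewrite big_cons; exact: cvgD.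
Qed.

Lemma cvg_mx (T : Type) (F : set_system T) (p q : nat)
    (f : T -> 'M[R]_(p, q)) (l : 'M[R]_(p, q)) :
  Filter F -> (forall i j, f x i j @[x --> F] --> l i j) -> f x @[x --> F] --> l.
Proof.
move=> FF fl; apply/cvgrPdist_le => e e0.
have H : \forall x \near F, forall ij, `|l ij.1 ij.2 - f x ij.1 ij.2| <= e.
  apply: filter_forall => -[i j] /=.
  by have /cvgrPdist_le /(_ e e0) := fl i j.
apply: filterS H => x H; apply: mx_norm_leP; first exact: ltW.
by move=> i j; rewrite !mxE; exact: (H (i, j)).
Qed.

Lemma cvg_mulmx (T : Type) (F : set_system T) p q r (f : T -> 'M[R]_(p, q))
    (g : T -> 'M[R]_(q, r)) (a : 'M[R]_(p, q)) (b : 'M[R]_(q, r)) :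
  Filter F -> f x @[x --> F] --> a -> g x @[x --> F] --> b ->
  (f x *m g x) @[x --> F] --> a *m b.
Proof.
move=> FF fa gb; apply: cvg_mx => i j.
under eq_fun do rewrite mxE.
rewrite mxE; apply: cvg_sumr => k; apply: cvgM.
- apply: (@cvg_comp _ _ _ f (fun M : 'M[R]_(p, q) => M i k)); first exact: fa.
  exact: coord_continuous.
- apply: (@cvg_comp _ _ _ g (fun M : 'M[R]_(q, r) => M k j)); first exact: gb.
  exact: coord_continuous.
Qed.

Lemma cvg_exprmx (T : Type) (F : set_system T) n (f : T -> 'M[R]_n) (a : 'M[R]_n) k :
  Filter F -> f x @[x --> F] --> a -> (f x ^+ k) @[x --> F] --> a ^+ k.
Proof.
move=> FF fa; elim: k => [|k IH].
  by rewrite expr0; under eq_fun do rewrite expr0; exact: cvg_cst.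
by rewrite exprS; under eq_fun do rewrite exprS; exact: cvg_mulmx.
Qed.

Lemma cvg0_le (V : normedModType R) (f : nat -> V) (g : nat -> R) :
  (\forall k \near \oo, `|f k| <= g k) -> g k @[k --> \oo] --> (0 : R) ->
  f k @[k --> \oo] --> (0 : V).
Proof.
move=> fg g0; apply/cvgrPdist_lt => e e0.
move/cvgrPdist_lt: g0 => /(_ e e0); apply: filterS2 fg => k fgk.
rewrite !sub0r !normrN; apply: le_lt_trans.
exact: le_trans fgk (ler_norm _).
Qed.

End MatrixLimits.

(** * The integral of the matrix exponential and constant controls *)

Section ExponentialBound.
Context (R : realType).
Implicit Types (c : R^nat) (B b t : R).

(** Comparison with the exponential series, with an explicit bound that later
    yields Lipschitz constants. *)
Lemma cvg_pseries_exp_bound c B b t : 0 <= b ->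
    (forall k, `|c k| <= B * (b ^+ k / k`!%:R)) ->
  cvgn (pseries c t) /\ `|limn (pseries c t)| <= B * expR (b * `|t|).
Proof.
move=> b0 cB.
have B0 : 0 <= B.
  by have := cB 0%N; rewrite expr0 fact0 divr1 mulr1; apply: le_trans.
have termB k : `|c k * t ^+ k| <= B * exp_coeff (b * `|t|) k.
  rewrite normrM normrX /exp_coeff /= exprMn.
  have -> : B * (b ^+ k * `|t| ^+ k / k`!%:R) = B * (b ^+ k / k`!%:R) * `|t| ^+ k.
    by ring.
  by rewrite ler_wpM2r ?exprn_ge0.
have cvgB : cvgn (series (fun k => B * exp_coeff (b * `|t|) k)).
  exact/is_cvg_seriesZ/is_cvg_series_exp_coeff.
have exp0 k : 0 <= B * exp_coeff (b * `|t|) k.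
  exact: le_trans (normr_ge0 _) (termB k).
have ncv : cvgn [normed pseries c t].
  by apply: (series_le_cvg _ exp0 termB) => // k; exact: normr_ge0.
split; first exact: normed_cvg.
apply: le_trans (lim_series_norm ncv) _.
apply: le_trans (lim_series_le ncv cvgB termB) _.
have -> : (fun k => B * exp_coeff (b * `|t|) k) = B *: exp_coeff (b * `|t|).
  by apply/funext.
by rewrite lim_seriesZ//; exact: is_cvg_series_exp_coeff.
Qed.

End ExponentialBound.

Section ExpIntegral.
Context (R : realType) (n : nat).
Implicit Types (M N : 'M[R]_n) (t : R).

(** Coefficients of [sum_k t^(k+1) M^k / (k+1)!], entry by entry, so that the
    scalar theory of power series applies. *)
Definition expint_coef M i j (k : nat) : R :=
  if k is k'.+1 then (M ^+ k') i j / k`!%:R else 0.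

(** This is [int_0^t exp(s M) ds]; the exponential itself is recovered as
    [exp(t M) = 1 + M * expint t M].  Unlike [M^-1 (exp(t M) - 1)], the series
    makes sense for singular [M]. *)
Definition expint t M : 'M[R]_n :=
  \matrix_(i, j) limn (pseries (expint_coef M i j) t).

Lemma norm_exprmx M a k : n%:R * `|M| <= a -> 1 <= a -> `|M ^+ k| <= a ^+ k.
Proof.
move=> Ma a1; elim: k => [|k IH].
  rewrite !expr0; apply: mx_norm_leP => // i j.
  by rewrite mxE; case: (_ == _); rewrite ?normr1 ?normr0.
rewrite !exprS (le_trans (ler_norm_mulmx _ _))//.
by rewrite ler_pM// mulr_ge0.
Qed.

Let bd M := n%:R * `|M| + 1.

Lemma expint_coef_le M i j a k : n%:R * `|M| <= a -> 1 <= a ->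
  `|expint_coef M i j k| <= a ^+ k / k`!%:R.
Proof.
move=> Ma a1; have a0 : 0 <= a by exact: le_trans a1.
case: k => [|k] /=; first by rewrite normr0 expr0 divr1.
rewrite normrM [`|_^-1|]ger0_norm// ler_wpM2r//.
rewrite (le_trans (mx_entry_le _ _ _))// (le_trans (norm_exprmx _ Ma a1))//.
by rewrite ler_weXn2l.
Qed.

Lemma pseries_diffs_expint_coef M i j k :
  pseries_diffs (expint_coef M i j) k = (M ^+ k) i j / k`!%:R.
Proof.
rewrite /pseries_diffs /= factS natrM invfM [_^-1 / _]mulrC.
by rewrite [LHS]mulrC -!mulrA mulVf ?mulr1// pnatr_eq0.
Qed.

Lemma pseries_diffs2_expint_coef M i j k :
  pseries_diffs (pseries_diffs (expint_coef M i j)) k =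
  (M ^+ k.+1) i j / k`!%:R.
Proof.
rewrite {1}/pseries_diffs pseries_diffs_expint_coef factS natrM invfM.
by rewrite [_^-1 / _]mulrC [LHS]mulrC -!mulrA mulVf ?mulr1// pnatr_eq0.
Qed.

(** The termwise derivative of the series is [exp(t M)], whose series without
    its constant term is [M] times the original one. *)
Lemma pseries_expint_relation M i j t :
  limn (pseries (pseries_diffs (expint_coef M i j)) t) =
  (1%:M + M *m expint t M) i j.
Proof.
have a1 : 1 <= bd M by rewrite lerDr mulr_ge0.
have Ma : n%:R * `|M| <= bd M by rewrite lerDl.
have a0 : 0 <= bd M by exact: le_trans a1.
have partialE k : pseries (pseries_diffs (expint_coef M i j)) t k.+1 =
    (1%:M : 'M[R]_n) i j + \sum_l M i l * pseries (expint_coef M l j) t k.+1.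
  rewrite /pseries /series /= big_nat_recl//= pseries_diffs_expint_coef.
  rewrite expr0 fact0 divr1 expr0 mulr1; congr (_ + _).
  under [RHS]eq_bigr => l _ do rewrite big_nat_recl//= mul0r add0r mulr_sumr.
  rewrite exchange_big/=; apply: eq_bigr => p _.
  rewrite pseries_diffs_expint_coef exprS mxE !mulr_suml.
  by apply: eq_bigr => l _; rewrite /= !mulrA.
apply: cvg_lim => //; rewrite -cvg_shiftS /=.
under eq_fun do rewrite partialE.
rewrite !mxE; apply: cvgD; first exact: cvg_cst.
apply: cvg_sumr => l; apply: cvgM; first exact: cvg_cst.
rewrite mxE.
rewrite (cvg_shiftS (pseries (expint_coef M l j) t)).
apply: (@cvg_pseries_exp_bound _ _ 1 (bd M) _ a0 _).1 => k.
by rewrite mul1r expint_coef_le.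
Qed.

Lemma is_derive_expint M i j t :
  is_derive t (1 : R) (fun s => expint s M i j) ((1%:M + M *m expint t M) i j).
Proof.
have a1 : 1 <= bd M by rewrite lerDr mulr_ge0.
have Ma : n%:R * `|M| <= bd M by rewrite lerDl.
have a0 : 0 <= bd M by exact: le_trans a1.
under eq_fun do rewrite mxE.
rewrite -pseries_expint_relation.
apply: (@pseries_snd_diffs _ _ (`|t| + 1)).
- apply: (@cvg_pseries_exp_bound _ _ 1 (bd M) _ a0 _).1 => k.
  by rewrite mul1r expint_coef_le.
- apply: (@cvg_pseries_exp_bound _ _ 1 (bd M) _ a0 _).1 => k.
  rewrite pseries_diffs_expint_coef mul1r normrM [`|_^-1|]ger0_norm//.
  by rewrite ler_wpM2r// (le_trans (mx_entry_le _ _ _))// norm_exprmx.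
- apply: (@cvg_pseries_exp_bound _ _ (bd M) (bd M) _ a0 _).1 => k.
  rewrite pseries_diffs2_expint_coef normrM [`|_^-1|]ger0_norm// mulrA -exprS.
  by rewrite ler_wpM2r// (le_trans (mx_entry_le _ _ _))// norm_exprmx.
- by rewrite [ltRHS]ger0_norm ?ltrDl// addr_ge0.
Qed.

Lemma expint0 M : expint 0 M = 0.
Proof.
apply/matrixP => i j; rewrite !mxE.
rewrite (_ : pseries _ _ = fun=> 0); first exact: lim_cst.
apply/funext => k; rewrite /pseries /series /= big1// => -[|l] _ /=.
  by rewrite mul0r.
by rewrite expr0n /= mulr0.
Qed.

(** Telescoping gives a factor [k a^k]; the linear factor is absorbed by
    replacing [a] with [2 a], which keeps the bound geometric. *)
Lemma exprmx_lipschitz M N a k :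
    n%:R * `|M| <= a -> n%:R * `|N| <= a -> 1 <= a ->
  `|M ^+ k - N ^+ k| <= n%:R * (2 * a) ^+ k * `|M - N|.
Proof.
move=> Ma Na a1; have a0 : 0 <= a by exact: le_trans a1.
elim: k => [|k IH].
  by rewrite !expr0 subrr normr0 !mulr_ge0.
have -> : M ^+ k.+1 - N ^+ k.+1 = M *m (M ^+ k - N ^+ k) + (M - N) *m N ^+ k.
  by rewrite mulmxBr mulmxBl !exprS addrA subrK.
rewrite (le_trans (ler_normD _ _))//.
have h1 := ler_norm_mulmx M (M ^+ k - N ^+ k).
have h2 := ler_norm_mulmx (M - N) (N ^+ k).
have h3 : n%:R * `|M| * `|M ^+ k - N ^+ k| <=
    a * (n%:R * (2 * a) ^+ k * `|M - N|) by rewrite ler_pM// mulr_ge0.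
have h4 : n%:R * `|M - N| * `|N ^+ k| <= n%:R * `|M - N| * (2 * a) ^+ k.
  rewrite ler_wpM2l ?mulr_ge0// (le_trans (norm_exprmx _ Na a1))//.
  by rewrite lerXn2r ?nnegrE ?mulr_ge0//; lra.
apply: (le_trans (lerD (le_trans h1 h3) (le_trans h2 h4))).
rewrite exprS; set c := (2 * a) ^+ k; set d := `|M - N|.
have cd0 : 0 <= n%:R * c * d by rewrite /d !mulr_ge0// /c ?exprn_ge0// mulr_ge0.
have -> : a * (n%:R * c * d) + n%:R * d * c = (a + 1) * (n%:R * c * d) by ring.
have -> : n%:R * (2 * a * c) * d = 2 * a * (n%:R * c * d) by ring.
by rewrite ler_wpM2r//; lra.
Qed.

(** The difference of the two series is dominated by an exponential series
    scaled by the distance of the matrices. *)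
Lemma expint_lipschitz t r : exists2 K, 0 <= K & forall M N,
  `|M| <= r -> `|N| <= r -> `|expint t M - expint t N| <= K * `|M - N|.
Proof.
pose a := n%:R * `|r| + 1.
have a1 : 1 <= a by rewrite lerDr mulr_ge0.
have a0 : 0 <= a by exact: le_trans a1.
have b0 : 0 <= 2 * a by rewrite mulr_ge0.
exists (n%:R * expR (2 * a * `|t|)); first by rewrite mulr_ge0// expR_ge0.
move=> M N Mr Nr.
have Ma : n%:R * `|M| <= a.
  apply: (@le_trans _ _ (n%:R * `|r|)); last by rewrite lerDl.
  by rewrite ler_wpM2l// (le_trans Mr)// ler_norm.
have Na : n%:R * `|N| <= a.
  apply: (@le_trans _ _ (n%:R * `|r|)); last by rewrite lerDl.
  by rewrite ler_wpM2l// (le_trans Nr)// ler_norm.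
apply: mx_norm_leP => [|i j]; first by rewrite !mulr_ge0// expR_ge0.
rewrite !mxE.
have cv P : n%:R * `|P| <= a -> cvgn (pseries (expint_coef P i j) t).
  move=> Pa; apply: (@cvg_pseries_exp_bound _ _ 1 a _ a0 _).1 => k.
  by rewrite mul1r expint_coef_le.
pose c k := expint_coef M i j k - expint_coef N i j k.
have cE : pseries c t =
    pseries (expint_coef M i j) t - pseries (expint_coef N i j) t.
  apply/funext => k; rewrite /pseries /series /= fctE -sumrB.
  by apply: eq_bigr => l _; rewrite mulrBl.
have cB k : `|c k| <= n%:R * `|M - N| * ((2 * a) ^+ k / k`!%:R).
  rewrite /c; case: k => [|k] /=.
    by rewrite subrr normr0 !mulr_ge0 ?exprn_ge0.
  rewrite -mulrBl normrM [`|_^-1|]ger0_norm// mulrA ler_wpM2r//.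
  have := mx_entry_le (M ^+ k - N ^+ k) i j; rewrite !mxE => /le_trans; apply.
  apply: (le_trans (exprmx_lipschitz k Ma Na a1)).
  rewrite mulrAC ler_wpM2l ?mulr_ge0//.
  by rewrite ler_weXn2l//; lra.
have [_] := cvg_pseries_exp_bound t b0 cB.
rewrite cE limB; [|exact: cv|exact: cv].
by move=> h; rewrite mulrAC.
Qed.

End ExpIntegral.

Section ConstantControl.
Context (R : realType) (n m : nat) (sys : affine_system R n m).

(** Variation of constants for the constant right-hand side, written through
    [rhs sys u x] so that equilibria are visibly fixed. *)
Definition cst_flow (t : R) (u : 'cV[R]_m) (x : 'cV[R]_n) : 'cV[R]_n :=
  x + expint t (Au sys u) *m rhs sys u x.

Lemma rhs_cst_flow t u x :
  rhs sys u (cst_flow t u x) =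
  (1%:M + Au sys u *m expint t (Au sys u)) *m rhs sys u x.
Proof.
rewrite /cst_flow; set G := expint _ _; set b := rhs sys u x.
have bE : b = Au sys u *m x + sysC sys *m u + sysd sys by [].
rewrite /rhs mulmxDr mulmxDl mul1mx mulmxA [X in _ = X + _]bE.
by rewrite -!addrA; congr (_ + _); rewrite addrC -addrA.
Qed.

Lemma is_derive_cst_flow t u x i :
  is_derive t (1 : R) (fun s => cst_flow s u x i 0)
    (rhs sys u (cst_flow t u x) i 0).
Proof.
rewrite rhs_cst_flow; set b := rhs sys u x.
have -> : (fun s => cst_flow s u x i 0) = cst (x i 0) +
    \sum_j (b j 0 \*: (fun s => expint s (Au sys u) i j)).
  apply/funext => s; rewrite /cst_flow !mxE fctE fct_sumE; congr (_ + _).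
  by apply: eq_bigr => j _; rewrite mulrC.
rewrite mxE -[X in is_derive _ _ _ X]add0r.
apply: is_deriveD; apply: is_derive_eq.
  by apply: is_derive_sum => j; exact/is_deriveZ/is_derive_expint.
by apply: eq_bigr => j _; rewrite mulrC.
Qed.

Lemma trajectory_cst u x : trajectory sys x (fun=> u) (fun t => cst_flow t u x).
Proof.
have cphi : continuous (fun t => cst_flow t u x).
  move=> t; apply: cvg_mx => i j; rewrite ord1.
  apply: differentiable_continuous; apply/derivable1_diffP.
  exact: (@ex_derive _ _ _ _ _ _ _ (is_derive_cst_flow t u x i)).
have crhs i : continuous (fun t => rhs sys u (cst_flow t u x) i 0).
  have -> : (fun t => rhs sys u (cst_flow t u x) i 0) = (fun t =>
      \sum_j (sysA sys i j + \sum_k u k 0 * sysB sys k i j) *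
        cst_flow t u x j 0 +
      \sum_k sysC sys i k * u k 0 + sysd sys i 0).
    by apply/funext => t; exact: rhsE.
  move=> t.
  apply: cvgD; last exact: cvg_cst.
  apply: cvgD; last exact: cvg_cst.
  apply: cvg_sumr => j; apply: cvgM; first exact: cvg_cst.
  apply: (@continuous_comp _ _ _ (fun t : R => cst_flow t u x)
    (fun y : 'cV[R]_n => y j 0)); first exact: cphi.
  exact: coord_continuous.
split => //; first by rewrite /cst_flow expint0 mul0mx addr0.
move=> s t i; rewrite le_eqVlt => /predU1P[->|st].
  by rewrite set_itv1 Rintegral_set1 subrr.
have D r := is_derive_cst_flow r u x i.
rewrite /Rintegral (@continuous_FTC2 R _ (fun t => cst_flow t u x i 0)) //=.
- exact: continuous_subspaceT.
- have cp r : cst_flow t u x i 0 @[t --> r] --> cst_flow r u x i 0.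
    apply: (@continuous_comp _ _ _ (fun t : R => cst_flow t u x)
      (fun y : 'cV[R]_n => y i 0)); first exact: cphi.
    exact: coord_continuous.
  split; [by move=> r _; exact: ex_derive| |].
  + exact: cvg_at_right_filter.
  + exact: cvg_at_left_filter.
- by move=> r _; rewrite derive1E derive_val.
Qed.

End ConstantControl.

(** * Sampling preserves the Kalman rank condition *)

Section Sampling.
Context (R : realType) (n m : nat).
Implicit Types (A S : 'M[R]_n) (B D : 'M[R]_(n, m)).

(** The derivative of [expint] at time 0 is [exp(0) = 1]. *)
Lemma expint_dnbhs0 A : h^-1 *: expint h A @[h --> 0^'] --> (1%:M : 'M[R]_n).
Proof.
apply: cvg_mx => i j.
have D := is_derive_expint A i j 0.
pose g (s : R) := expint s A i j.
have : h^-1 *: ((g \o shift 0) (h *: 1) - g 0) @[h --> 0^'] --> 'D_1 g 0.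
  exact: ex_derive.
rewrite derive_val /g expint0 mulmx0 addr0; apply: cvg_trans.
apply: near_eq_cvg; apply: nearW => h /=.
by rewrite addr0 [h *: _]mulr1 !mxE subr0.
Qed.

Lemma near1_mulmx_inj k (w : 'M[R]_(k, n)) (W : 'M[R]_n) :
  n%:R * `|1%:M - W| < 1 -> w *m W = 0 -> w = 0.
Proof.
move=> W1 wW0; apply/eqP; rewrite -normr_eq0.
have : `|w| <= n%:R * `|1%:M - W| * `|w|.
  rewrite mulrAC; apply: le_trans (ler_norm_mulmx _ _).
  by rewrite mulmxBr mulmx1 wW0 subr0.
rewrite -subr_ge0 -{2}[`|w|]mul1r -mulrBl nmulr_rge0 ?subr_lt0// => w0.
by rewrite eq_le w0 normr_ge0.
Qed.

(** Powers of [S - 1] are combinations of powers of [S] of at most the same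
    degree, so a matrix annihilating the reachable directions of [(S, D)] from
    the left annihilates those of [(S - 1, D)]. *)
Lemma mulmx_iter_diff p (w : 'M[R]_(p, n)) S D N :
  (forall i, (i < N)%N -> w *m (S ^+ i *m D) = 0) ->
  forall j i, (i + j < N)%N -> w *m (S ^+ i *m ((S - 1) ^+ j *m D)) = 0.
Proof.
move=> H; elim=> [|j IH] i ijN.
  by rewrite expr0 mul1mx H// -(addn0 i).
have -> : S ^+ i *m ((S - 1) ^+ j.+1 *m D) =
    S ^+ i.+1 *m ((S - 1) ^+ j *m D) - S ^+ i *m ((S - 1) ^+ j *m D).
  rewrite exprS exprSr -[(S - 1) * _]/((S - 1) *m _) -[_ * S]/(_ *m S).
  by rewrite -!mulmxA mulmxBl mul1mx mulmxBr.
rewrite mulmxBr !IH ?subr0// ?addSnnS//.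
by rewrite (leq_trans _ ijN)// addnS ltnW.
Qed.

Lemma exprmxZ c A k : (c *: A) ^+ k = c ^+ k *: A ^+ k.
Proof.
elim: k => [|k IH]; first by rewrite !expr0 scale1r.
by rewrite !exprS IH -[LHS]/(_ *m _) -scalemxAl -scalemxAr scalerA.
Qed.

(** The rank condition survives sampling with a small step.  Since
    [S - 1 = G A], the reachable directions of [(S, G B)] contain the columns of
    [(G A)^k G B]; divided by the power [k + 1] of the step these converge to
    [A^k B], because [G / t] tends to [1].  Full rank is an open
    condition. *)
Lemma exists_sampling A B : \rank (\mxrow_(k < n) (A ^+ k *m B)) = n ->
  exists2 t, 0 < t & exists K : nat -> 'M[R]_(m, n),
    \sum_(k < n) (1%:M + expint t A *m A) ^+ (n - k.+1) *m
      (expint t A *m B *m K k) = 1%:M.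
Proof.
move=> rk.
have : row_free (\mxrow_(k < n) (A ^+ k *m B)) by apply/eqP.
move=> /row_freeP[Y VY].
pose Yk k := submxcol Y k.
have {VY}VY : \sum_(k < n) A ^+ k *m B *m Yk k = 1%:M.
  by rewrite -VY -[in RHS](submxcolK Y) mul_mxrow_mxcol.
(* [Y] is a right inverse of the Kalman matrix; [W h] perturbs [1]. *)
pose W h := \sum_(k < n) ((h^-1 *: expint h A) *m A) ^+ k *m
  ((h^-1 *: expint h A) *m B) *m Yk k.
have cW : W h @[h --> 0^'] --> (1%:M : 'M[R]_n).
  rewrite -VY; apply: cvg_sumr => k.
  apply: cvg_mulmx; last exact: cvg_cst.
  apply: cvg_mulmx.
    rewrite -[A in A ^+ k]mul1mx; apply: cvg_exprmx.
    by apply: cvg_mulmx; [exact: expint_dnbhs0|exact: cvg_cst].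
  rewrite -[X in _ --> X]mul1mx.
  by apply: cvg_mulmx; [exact: expint_dnbhs0|exact: cvg_cst].
have /cvgrPdist_lt/(_ (n%:R + 1)^-1) := cW.
have n1 : 0 < n%:R + 1 :> R by rewrite ltr_wpDl.
rewrite invr_gt0 => /(_ n1) [d /= d0 Hd].
pose t := d / 2.
have t0 : 0 < t by rewrite divr_gt0.
have Wt : `|1%:M - W t| < (n%:R + 1)^-1.
  apply: Hd; last by rewrite gt_eqF.
  by rewrite /ball_/= sub0r normrN gtr0_norm// /t; lra.
exists t => //.
set G := expint t A; set S := 1%:M + G *m A.
(* A row vector in the left kernel is killed by [W t], which is invertible. *)
have free : row_free (\mxrow_(k < n) (S ^+ k *m (G *m B))).
  apply: inj_row_free => w; rewrite mul_mxrow -mxrow0 => /eq_mxrowP w0.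
  have wS i : (i < n)%N -> w *m (S ^+ i *m (G *m B)) = 0.
    by move=> i_n; exact: (w0 (Ordinal i_n)).
  have wGA k : (k < n)%N -> w *m ((G *m A) ^+ k *m (G *m B)) = 0.
    move=> kn; have := mulmx_iter_diff wS (j := k) (i := 0) kn.
    by rewrite expr0 mul1mx /S addrAC subrr add0r.
  apply: (near1_mulmx_inj (W := W t)).
    apply: (@le_lt_trans _ _ (n%:R / (n%:R + 1))).
      by rewrite ler_wpM2l// ltW.
    by rewrite ltr_pdivrMr// mul1r ltrDl.
  rewrite /W mulmx_sumr big1// => k _.
  rewrite -!scalemxAl exprmxZ -!scalemxAl -!scalemxAr -/G.
  by rewrite -scalemxAl -scalemxAr mulmxA wGA// mul0mx !scaler0.
have /row_freeP[X VX] := free.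
(* The block for the power [k] of [S] is the control of the step with [k]
   steps still to follow it, hence the reversal of indices. *)
exists (fun k => if insub (n - k.+1)%N is Some i then submxcol X i else 0).
rewrite -VX -[X in RHS](submxcolK X) mul_mxrow_mxcol.
rewrite (reindex_inj rev_ord_inj) /=; apply: eq_bigr => k _.
rewrite subnSK// subKn; last exact: ltnW.
by rewrite valK mulmxA.
Qed.

End Sampling.

(** * Remainders with arbitrarily small Lipschitz constant *)

Section SmallRemainder.
Context (R : realType).

Definition loc_lipschitz (U V W : normedModType R) (f : U -> V -> W) :=
  exists2 K, 0 <= K & exists2 d, 0 < d & forall a a' b b',
    `|a| <= d -> `|a'| <= d -> `|b| <= d -> `|b'| <= d ->
    `|f a b - f a' b'| <= K * (`|a - a'| + `|b - b'|).

(** For a map vanishing at the origin this says that it is strictly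
    differentiable there with derivative 0.  Strict differentiability, unlike
    differentiability, gives contractions. *)
Definition small (U V W : normedModType R) (r : U -> V -> W) :=
  forall e, 0 < e -> exists2 d, 0 < d & forall a a' b b',
    `|a| <= d -> `|a'| <= d -> `|b| <= d -> `|b'| <= d ->
    `|r a b - r a' b'| <= e * (`|a - a'| + `|b - b'|).

Lemma small0 (U V W : normedModType R) : small (fun (_ : U) (_ : V) => 0 : W).
Proof.
move=> e e0; exists 1 => // a a' b b' _ _ _ _.
by rewrite subrr normr0 mulr_ge0// ?addr_ge0// ltW.
Qed.

Lemma smallD (U V W : normedModType R) (r s : U -> V -> W) :
  small r -> small s -> small (fun a b => r a b + s a b).
Proof.
move=> rs ss e e0; have e2 : 0 < e / 2 by rewrite divr_gt0.
have [d d0 rd] := rs _ e2; have [d' d'0 sd] := ss _ e2.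
exists (Num.min d d'); first by rewrite lt_min d0.
move=> a a' b b'; rewrite !le_min => /andP[ad ad'] /andP[a'd a'd'].
move=> /andP[bd bd'] /andP[b'd b'd'].
rewrite opprD addrACA (le_trans (ler_normD _ _))//.
rewrite (le_trans (lerD (rd _ _ _ _ ad a'd bd b'd) (sd _ _ _ _ ad' a'd' bd' b'd')))//.
by rewrite -mulrDl -splitr.
Qed.

Lemma loc_lipschitzD (U V W : normedModType R) (f g : U -> V -> W) :
  loc_lipschitz f -> loc_lipschitz g -> loc_lipschitz (fun a b => f a b + g a b).
Proof.
move=> [K K0 [d d0 fd]] [L L0 [d' d'0 gd]].
exists (K + L); first exact: addr_ge0.
exists (Num.min d d'); first by rewrite lt_min d0.
move=> a a' b b'; rewrite !le_min => /andP[ad ad'] /andP[a'd a'd'].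
move=> /andP[bd bd'] /andP[b'd b'd'].
rewrite opprD addrACA (le_trans (ler_normD _ _))// mulrDl.
by rewrite lerD ?fd ?gd.
Qed.

Lemma small_loc_lipschitz (U V W : normedModType R) (r : U -> V -> W) :
  small r -> loc_lipschitz r.
Proof. by move=> /(_ 1 ltr01); exists 1. Qed.

(** The scaling of [e] by the Lipschitz constants of the inner maps compensates
    their expansion. *)
Lemma small_comp (U V U' V' W : normedModType R) (r : U -> V -> W)
    (f : U' -> V' -> U) (g : U' -> V' -> V) :
  small r -> loc_lipschitz f -> loc_lipschitz g -> f 0 0 = 0 -> g 0 0 = 0 ->
  small (fun a b => r (f a b) (g a b)).
Proof.
move=> sr [K K0 [d d0 fd]] [L L0 [d' d'0 gd]] f0 g0 e e0.
have KL : 0 < K + L + 1 by rewrite ltr_wpDl// addr_ge0.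
have [c c0 rc] := sr (e / (K + L + 1)) (divr_gt0 e0 KL).
pose m := Num.min (Num.min d d') (c / (2 * (K + L + 1))).
have m0 : 0 < m by rewrite !lt_min d0 d'0 divr_gt0// mulr_gt0.
have bnd a b : `|a| <= m -> `|b| <= m -> `|f a b| <= c /\ `|g a b| <= c.
  rewrite /m !le_min => /andP[/andP[ad ad'] ac] /andP[/andP[bd bd'] bc].
  have h1 := fd a 0 b 0 ad; rewrite !normr0 !subr0 f0 subr0 in h1.
  have h2 := gd a 0 b 0 ad'; rewrite !normr0 !subr0 g0 subr0 in h2.
  have s : `|a| + `|b| <= c / (K + L + 1).
    rewrite (le_trans (lerD ac bc))// invfM mulrCA -mulrDl.
    by rewrite [X in X * _](_ : _ = 1) ?mul1r//; field.
  have bound M : 0 <= M -> M <= K + L + 1 -> M * (`|a| + `|b|) <= c.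
    move=> M0 ML; rewrite (le_trans (ler_wpM2l M0 s))//.
    by rewrite mulrCA ger_pMr// ler_pdivrMr// mul1r.
  split.
  - by apply: (le_trans (h1 (ltW d0) bd (ltW d0))); apply: bound => //; lra.
  - by apply: (le_trans (h2 (ltW d'0) bd' (ltW d'0))); apply: bound => //; lra.
exists m => // a a' b b' am a'm bm b'm.
have [fab gab] := bnd _ _ am bm; have [fab' gab'] := bnd _ _ a'm b'm.
rewrite (le_trans (rc _ _ _ _ fab fab' gab gab'))//.
move: am a'm bm b'm; rewrite /m !le_min.
move=> /andP[/andP[ad ad'] _] /andP[/andP[a'd a'd'] _].
move=> /andP[/andP[bd bd'] _] /andP[/andP[b'd b'd'] _].
have h1 := fd _ _ _ _ ad a'd bd b'd.
have h2 := gd _ _ _ _ ad' a'd' bd' b'd'.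
rewrite -mulrA ler_pM2l// ler_pdivrMl// (le_trans (lerD h1 h2))//.
by rewrite -mulrDl ler_wpM2r ?addr_ge0//; lra.
Qed.

(** A product of two Lipschitz maps that both vanish at the origin is of second
    order. *)
Lemma small_mulmx (U V : normedModType R) p q (P : U -> V -> 'M[R]_(p, q))
    (l : U -> V -> 'cV[R]_q) :
  loc_lipschitz P -> P 0 0 = 0 -> loc_lipschitz l -> l 0 0 = 0 ->
  small (fun a b => P a b *m l a b).
Proof.
move=> [K K0 [d d0 Pd]] P0 [L L0 [d' d'0 ld]] l0 e e0.
pose c := q%:R * K * L * 4 + 1.
have c0 : 0 < c by rewrite ltr_wpDl// !mulr_ge0.
pose m := Num.min (Num.min d d') (e / c).
have m0 : 0 < m by rewrite !lt_min d0 d'0 divr_gt0.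
exists m => // a a' b b' am a'm bm b'm.
set D := `|a - a'| + `|b - b'|.
have D0 : 0 <= D by rewrite addr_ge0.
have md : m <= d by rewrite /m !ge_min lexx.
have md' : m <= d' by rewrite /m !ge_min lexx orbT.
have mc : m <= e / c by rewrite /m ge_min lexx orbT.
have Pab : `|P a b| <= K * (2 * m).
  have := Pd a 0 b 0; rewrite !normr0 !subr0 P0 subr0 => h.
  apply: (le_trans (h (le_trans am md) (ltW d0) (le_trans bm md) (ltW d0))).
  by rewrite ler_wpM2l//; lra.
have lab : `|l a' b'| <= L * (2 * m).
  have := ld a' 0 b' 0; rewrite !normr0 !subr0 l0 subr0 => h.
  apply: (le_trans (h (le_trans a'm md') (ltW d'0) (le_trans b'm md') (ltW d'0))).
  by rewrite ler_wpM2l//; lra.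
have dP : `|P a b - P a' b'| <= K * D by apply: Pd; exact: le_trans md.
have dl : `|l a b - l a' b'| <= L * D by apply: ld; exact: le_trans md'.
have -> : P a b *m l a b - P a' b' *m l a' b' =
   P a b *m (l a b - l a' b') + (P a b - P a' b') *m l a' b'.
  by rewrite mulmxBr mulmxBl addrA subrK.
rewrite (le_trans (ler_normD _ _))//.
have h1 : `|P a b *m (l a b - l a' b')| <= q%:R * (K * (2 * m)) * (L * D).
  rewrite (le_trans (ler_norm_mulmx _ _))// ler_pM ?mulr_ge0//.
  by rewrite ler_wpM2l.
have h2 : `|(P a b - P a' b') *m l a' b'| <= q%:R * (K * D) * (L * (2 * m)).
  rewrite (le_trans (ler_norm_mulmx _ _))// ler_pM ?mulr_ge0//.
  by rewrite ler_wpM2l.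
rewrite (le_trans (lerD h1 h2))//.
have -> : q%:R * (K * (2 * m)) * (L * D) + q%:R * (K * D) * (L * (2 * m)) =
   (q%:R * K * L * 4 * m) * D by ring.
rewrite ler_wpM2r//.
have : c * m <= e by rewrite mulrC -ler_pdivlMr.
by apply: le_trans; rewrite /c mulrDl mul1r lerDl ltW.
Qed.

Lemma loc_lipschitz_mulmx (U V : normedModType R) p q (P : 'M[R]_(p, q))
    (l : U -> V -> 'cV[R]_q) :
  loc_lipschitz l -> loc_lipschitz (fun a b => P *m l a b).
Proof.
move=> [L L0 [d d0 ld]]; exists (q%:R * `|P| * L); first by rewrite !mulr_ge0.
exists d => // a a' b b' ad a'd bd b'd.
rewrite -mulmxBr (le_trans (ler_norm_mulmx _ _))// -mulrA.
by rewrite -[leRHS]mulrA -mulrA !ler_wpM2l// ld.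
Qed.

Lemma small_mulmxl (U V : normedModType R) p q (P : 'M[R]_(p, q))
    (l : U -> V -> 'cV[R]_q) :
  small l -> small (fun a b => P *m l a b).
Proof.
move=> sl e e0; have c0 : 0 < q%:R * `|P| + 1 by rewrite ltr_wpDl// mulr_ge0.
have [d d0 ld] := sl (e / (q%:R * `|P| + 1)) (divr_gt0 e0 c0).
exists d => // a a' b b' ad a'd bd b'd.
rewrite -mulmxBr (le_trans (ler_norm_mulmx _ _))//.
have h := ld _ _ _ _ ad a'd bd b'd.
rewrite (le_trans (ler_wpM2l _ h)) ?mulr_ge0// mulrA ler_wpM2r ?addr_ge0//.
by rewrite mulrCA ger_pMr// ler_pdivrMr// mul1r lerDl.
Qed.

Lemma loc_lipschitz_fst (U V : normedModType R) :
  loc_lipschitz (fun (a : U) (b : V) => a).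
Proof.
by exists 1 => //; exists 1 => // a a' b b' *; rewrite mul1r lerDl.
Qed.

Lemma loc_lipschitz_snd (U V : normedModType R) :
  loc_lipschitz (fun (a : U) (b : V) => b).
Proof.
by exists 1 => //; exists 1 => // a a' b b' *; rewrite mul1r lerDr.
Qed.

Lemma loc_lipschitz_cst (U V W : normedModType R) (w : W) :
  loc_lipschitz (fun (_ : U) (_ : V) => w).
Proof.
by exists 0 => //; exists 1 => // *; rewrite subrr normr0 mul0r.
Qed.

Lemma loc_lipschitz_mulmx2 (U V : normedModType R) p q r
    (f : U -> V -> 'M[R]_(p, q)) (g : U -> V -> 'M[R]_(q, r)) :
  loc_lipschitz f -> loc_lipschitz g ->
  loc_lipschitz (fun a b => f a b *m g a b).
Proof.
move=> [K K0 [d d0 fd]] [L L0 [d' d'0 gd]].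
pose c := Num.min d d'.
have c0 : 0 < c by rewrite lt_min d0.
have cd : c <= d by rewrite /c ge_min lexx.
have cd' : c <= d' by rewrite /c ge_min lexx orbT.
pose M := `|f 0 0| + K * (c + c); pose N := `|g 0 0| + L * (c + c).
have M0 : 0 <= M by rewrite addr_ge0// mulr_ge0// addr_ge0// ltW.
have N0 : 0 <= N by rewrite addr_ge0// mulr_ge0// addr_ge0// ltW.
exists (q%:R * M * L + q%:R * K * N); first by rewrite addr_ge0// !mulr_ge0.
exists c => // a a' b b' ac a'c bc b'c.
have fM : `|f a b| <= M.
  have := fd a 0 b 0 (le_trans ac cd).
  rewrite !normr0 !subr0 => /(_ (ltW d0) (le_trans bc cd) (ltW d0)) h.
  rewrite -[f a b](subrK (f 0 0)) addrC (le_trans (ler_normD _ _))//.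
  by rewrite lerD2l (le_trans h)// ler_wpM2l// lerD.
have gN : `|g a' b'| <= N.
  have := gd a' 0 b' 0 (le_trans a'c cd').
  rewrite !normr0 !subr0 => /(_ (ltW d'0) (le_trans b'c cd') (ltW d'0)) h.
  rewrite -[g a' b'](subrK (g 0 0)) addrC (le_trans (ler_normD _ _))//.
  by rewrite lerD2l (le_trans h)// ler_wpM2l// lerD.
have df := fd _ _ _ _ (le_trans ac cd) (le_trans a'c cd) (le_trans bc cd)
  (le_trans b'c cd).
have dg := gd _ _ _ _ (le_trans ac cd') (le_trans a'c cd') (le_trans bc cd')
  (le_trans b'c cd').
have -> : f a b *m g a b - f a' b' *m g a' b' =
   f a b *m (g a b - g a' b') + (f a b - f a' b') *m g a' b'.
  by rewrite mulmxBr mulmxBl addrA subrK.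
rewrite (le_trans (ler_normD _ _))// mulrDl lerD//.
- rewrite (le_trans (ler_norm_mulmx _ _))// -[leRHS]mulrA ler_pM ?mulr_ge0//.
  by rewrite ler_wpM2l.
- rewrite (le_trans (ler_norm_mulmx _ _))//.
  rewrite [leRHS](_ : _ = q%:R * (K * (`|a - a'| + `|b - b'|)) * N); last by ring.
  rewrite ler_pM ?mulr_ge0//.
  by rewrite ler_wpM2l.
Qed.

End SmallRemainder.

Section SmallSolve.
Context (R : realType).

(** The contraction principle needs completeness and the norm in one structure. *)
HB.instance Definition _ (p q : nat) := Complete.on 'M[R]_(p, q).

(** The perturbation [b |-> b + r a b] of the identity is inverted by the
    contraction [b |-> c - r a b], uniformly in the parameter [a]. *)
Lemma small_solve (U : normedModType R) (V : completeNormedModType R)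
    (r : U -> V -> V) (d0 : R) :
  small r -> r 0 0 = 0 -> 0 < d0 ->
  exists2 h, 0 < h & forall a c, `|a| <= h -> `|c| <= h ->
    exists2 b, `|b| <= d0 & c = b + r a b.
Proof.
move=> sr r0 d00.
have [d d_gt0 rd] := sr 4^-1 ltac:(by rewrite invr_gt0).
pose e := Num.min d d0.
have e0 : 0 < e by rewrite lt_min d_gt0.
have ed : e <= d by rewrite /e ge_min lexx.
exists (e / 2); first by rewrite divr_gt0.
move=> a c ae ce.
have ad : `|a| <= d by rewrite (le_trans ae)//; lra.
pose B := [set b : V | `|b| <= e].
pose f b := c - r a b.
(* On the ball the remainder varies by a quarter of the distance, so it maps
   the ball into itself when [a] and [c] are at most half its radius. *)
have fB : set_fun B B f.
  move=> b Bb; rewrite /B /f /= in Bb *.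
  have := rd a 0 b 0 ad; rewrite !normr0 !subr0 r0 subr0.
  move=> /(_ (ltW d_gt0) (le_trans Bb ed) (ltW d_gt0)) h.
  rewrite (le_trans (ler_normB _ _))//; lra.
pose fm := isFun.Build _ _ B B f fB.
pose F : {fun B >-> B} := HB.pack f fm.
have ctr : is_contraction F.
  exists (4^-1)%:nng; split => /=; first by lra.
  move=> [b b'] [/= Bb Bb'].
  have := rd a a b b' ad ad (le_trans Bb ed) (le_trans Bb' ed).
  rewrite subrr normr0 add0r /f => h.
  by rewrite opprB addrC subrKA distrC.
have clB : closed B.
  have -> : B = (fun b : V => `|b|) @^-1` [set x | x <= e] by [].
  apply: closed_comp; last exact: closed_le.
  by move=> x _; exact: norm_continuous.
have [|b Bb bE] := banach_fixed_point ctr clB.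
  by exists 0; rewrite /B /= normr0 ltW.
exists b; first by rewrite (le_trans Bb)// /e ge_min lexx orbT.
by rewrite {1}bE /= /f subrK.
Qed.

End SmallSolve.

(** * Local controllability at a regular equilibrium *)

Section LocalControllability.
Context (R : realType) (n m : nat) (sys : affine_system R n m).

Lemma AuD u v : Au sys (u + v) = Au sys u + \sum_i v i 0 *: sysB sys i.
Proof.
rewrite /Au -addrA -big_split/=; congr (_ + _).
by apply: eq_bigr => i _; rewrite mxE scalerDl.
Qed.

(** At an equilibrium the constant terms cancel, and [Bprime] collects every
    contribution of the control variation that is of first order. *)
Lemma rhs_perturb u x v y : equilibrium sys u x ->
  rhs sys (u + v) (x + y) = Au sys (u + v) *m y + Bprime sys x *m v.
Proof.
move=> ux.
have -> : Bprime sys x *m v =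
    sysC sys *m v + (\sum_i v i 0 *: sysB sys i) *m x.
  rewrite /Bprime mulmxDl; congr (_ + _).
  apply/matrixP => i j; rewrite ord1 mulmx_suml summxE mxE.
  by apply: eq_bigr => k _; rewrite -scalemxAl !mxE mulrC.
rewrite /rhs !mulmxDr {1}AuD mulmxDl.
have E : Au sys u *m x + sysC sys *m u + sysd sys = 0 by exact: esym ux.
move: E; set a := Au sys u *m x; set b := _ *m u; set c := sysd sys.
set e := Au _ _ *m y; set f := _ *m x; set g := _ *m v => E.
rewrite -[RHS]addr0 -E.
by apply/matrixP => i j; rewrite !mxE; ring.
Qed.

Lemma Au_lipschitz (U : normedModType R) u :
  loc_lipschitz (fun (_ : U) v => Au sys (u + v)).
Proof.
exists (\sum_i `|sysB sys i|); first by rewrite sumr_ge0.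
exists 1 => // a a' b b' _ _ _ _.
rewrite !AuD opprD addrACA subrr add0r -sumrB.
rewrite (le_trans (ler_norm_sum _ _ _))// mulr_suml; apply: ler_sum => i _.
rewrite -scalerBl normrZ mulrC ler_wpM2l//.
have := mx_entry_le (b - b') i 0; rewrite !mxE => /le_trans; apply.
by rewrite lerDr.
Qed.

Lemma expint_Au_lipschitz (U : normedModType R) t u :
  loc_lipschitz (fun (_ : U) v => expint t (Au sys (u + v))).
Proof.
have [L L0 [d d0 Ld]] := Au_lipschitz U u.
have [K K0 HK] := @expint_lipschitz R n t (`|Au sys u| + L * d).
exists (K * L); first by rewrite mulr_ge0.
have bnd b : `|b| <= d -> `|Au sys (u + b)| <= `|Au sys u| + L * d.
  move=> bd; rewrite -[Au sys (u + b)](subrK (Au sys u)) addrC.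
  rewrite (le_trans (ler_normD _ _))// lerD2l.
  have := Ld 0 0 b 0; rewrite !normr0 subrr normr0 add0r subr0 addr0.
  move=> /(_ (ltW d0) (ltW d0) bd (ltW d0)) /le_trans; apply.
  by rewrite ler_wpM2l.
exists d => // a a' b b' ad a'd bd b'd.
rewrite (le_trans (HK _ _ (bnd _ bd) (bnd _ b'd)))// -mulrA ler_wpM2l//.
exact: Ld.
Qed.

(** Strict differentiability of one step at the equilibrium.  The remainder is
    bilinear in the state or control variation and in the variation of [expint]
    caused by the control, hence of second order. *)
Lemma cst_flow_expansion t u x : equilibrium sys u x ->
  let G := expint t (Au sys u) in
  exists r : 'cV[R]_n -> 'cV[R]_m -> 'cV[R]_n, [/\ small r, r 0 0 = 0 &
    forall y v, cst_flow sys t (u + v) (x + y) - x =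
      (1%:M + G *m Au sys u) *m y + G *m Bprime sys x *m v + r y v].
Proof.
move=> ux G.
exists (fun y v =>
  (expint t (Au sys (u + v)) *m Au sys (u + v) - G *m Au sys u) *m y +
  ((expint t (Au sys (u + v)) - G) *m Bprime sys x) *m v).
split; last 2 first.
- by rewrite !mulmx0 addr0.
- move=> y v; rewrite /cst_flow (rhs_perturb _ _ ux).
  move: (expint t (Au sys (u + v))) (Au sys (u + v)) G (Au sys u).
  move: (Bprime sys x) => B E A1 G A0.
  rewrite !mulmxDr !mulmxDl !mulNmx mul1mx !mulmxA.
  set e1 := _ *m y; set e2 := _ *m v; set e3 := _ *m y; set e4 := _ *m v.
  by apply/matrixP => i j; rewrite !mxE; ring.
apply: smallD; apply: small_mulmx.
- apply: loc_lipschitzD; last exact: loc_lipschitz_cst.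
  by apply: loc_lipschitz_mulmx2; [exact: expint_Au_lipschitz|exact: Au_lipschitz].
- by rewrite addr0 subrr.
- exact: loc_lipschitz_fst.
- by [].
- apply: loc_lipschitz_mulmx2; last exact: loc_lipschitz_cst.
  apply: loc_lipschitzD; last exact: loc_lipschitz_cst.
  exact: expint_Au_lipschitz.
- by rewrite addr0 subrr mul0mx.
- exact: loc_lipschitz_snd.
- by [].
Qed.

Local Notation Om := (sysOmega sys).

Lemma orbit_pos_cst t u x : 0 <= t -> Om u ->
  orbit_pos sys x (cst_flow sys t u x).
Proof.
move=> t0 Ou; exists t, (fun=> u), (fun s => cst_flow sys s u x); split => //.
  exact: admissible_cst.
exact: trajectory_cst.
Qed.

(** Piecewise constant control in coordinates centred at [x], with the value
    [u + K j b] on the [j]-th step: all controls depend linearly on one vector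
    [b] of the dimension of the state space, so that the endpoint equation is
    square. *)
Definition pw_flow (t : R) (u : 'cV[R]_m) (x : 'cV[R]_n)
    (K : nat -> 'M[R]_(m, n)) (k : nat) (a b : 'cV[R]_n) : 'cV[R]_n :=
  iteri k (fun j y => cst_flow sys t (u + K j *m b) (x + y) - x) a.

(** Iterating the one-step expansion: the linear parts follow the discrete
    variation of constants formula, and remainders compose. *)
Lemma pw_flow_expansion t u x K k : equilibrium sys u x ->
  let G := expint t (Au sys u) in let S := 1%:M + G *m Au sys u in
  exists r : 'cV[R]_n -> 'cV[R]_n -> 'cV[R]_n, [/\ small r, r 0 0 = 0 &
    forall a b, pw_flow t u x K k a b = S ^+ k *m a +
      (\sum_(j < k) S ^+ (k - j.+1) *m (G *m Bprime sys x *m K j)) *m b + r a b].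
Proof.
move=> ux G S.
have [r [sr r0 rE]] := cst_flow_expansion t ux.
elim: k => [|k [rk [srk rk0 rkE]]].
  exists (fun _ _ => 0); split => [|//|a b]; first exact: small0.
  by rewrite big_ord0 expr0 mul1mx mul0mx !addr0.
have lip : loc_lipschitz (pw_flow t u x K k).
  have -> : pw_flow t u x K k = (fun a b => S ^+ k *m a +
      (\sum_(j < k) S ^+ (k - j.+1) *m (G *m Bprime sys x *m K j)) *m b + rk a b).
    by apply/funext => a; apply/funext => b; exact: rkE.
  apply: loc_lipschitzD; last exact: small_loc_lipschitz.
  apply: loc_lipschitzD; apply: loc_lipschitz_mulmx.
    exact: loc_lipschitz_fst.
  exact: loc_lipschitz_snd.
have flow0 : pw_flow t u x K k 0 0 = 0 by rewrite rkE !mulmx0 rk0 !addr0.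
exists (fun a b => S *m rk a b + r (pw_flow t u x K k a b) (K k *m b)); split.
- apply: smallD; first exact: small_mulmxl.
  apply: (small_comp sr lip) => //; last exact: mulmx0.
  apply: loc_lipschitz_mulmx; exact: loc_lipschitz_snd.
- by rewrite flow0 rk0 !mulmx0 r0 addr0.
- move=> a b; rewrite {1}/pw_flow iteriS -/(pw_flow t u x K k a b) rE.
  rewrite {1}rkE -/G -/S big_ord_recr /= subnn expr0 mul1mx.
  move: (S) (G *m Bprime sys x) => T D.
  have -> : \sum_(j < k) T ^+ (k.+1 - j.+1) *m (D *m K j) =
     T *m \sum_(j < k) T ^+ (k - j.+1) *m (D *m K j).
    rewrite mulmx_sumr; apply: eq_bigr => j _.
    by rewrite subSS -(subnSK (ltn_ord j)) exprS -[T * _]/(T *m _) -!mulmxA.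
  rewrite exprS -[T * _]/(T *m _) !mulmxDr !mulmxDl !mulmxA -!addrA.
  congr (_ + (_ + _)); by rewrite addrCA.
Qed.

Lemma orbit_pos_pw_flow t u x K k a b : 0 <= t -> Om u ->
  (forall j, (j < k)%N -> Om (u + K j *m b)) ->
  orbit_pos sys (x + a) (x + pw_flow t u x K k a b).
Proof.
move=> t0 Ou; elim: k => [|k IH] OK.
  have := orbit_pos_cst (x + a) (lexx 0) Ou.
  by rewrite /cst_flow expint0 mul0mx addr0.
apply: orbit_pos_trans (IH _) _; first by move=> j jk; apply: OK; exact: ltnW.
rewrite /pw_flow iteriS -/(pw_flow t u x K k a b).
rewrite [x + (_ - x)]addrC subrK.
exact: orbit_pos_cst (OK _ (ltnSn k)).
Qed.

(** With the feedback matrices [K] provided by sampling, the endpoint of [n]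
    steps is [S^n a + b] plus a small remainder, so the control parameter [b]
    can be solved for every initial point [a] and every target near [x]. *)
Lemma locally_controllable u x : interior Om u -> equilibrium sys u x ->
  \rank (kalman_mx sys u x) = n -> nbhs x (mutually_reachable sys x).
Proof.
move=> iu ux rk.
have Ou : Om u := interior_subset iu.
have [t t0 [K HK]] := exists_sampling rk.
have [r [sr r0 rE]] := pw_flow_expansion t K n ux.
rewrite /= HK in rE.
have [e e0 eO] : exists2 e, 0 < e & forall v, `|v| <= e -> Om (u + v).
  have /nbhs_normP[e /= e0 eO] := iu.
  exists (e / 2); first by rewrite divr_gt0.
  move=> v ve; apply: eO; rewrite /ball_ /= opprD addNKr normrN.
  by rewrite (le_lt_trans ve)//; lra.
(* Bounding [b] by [e / c] keeps all control values in the ball inside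
   the control range. *)
pose c := n%:R * \sum_(j < n) `|K j| + 1.
have c0 : 0 < c by rewrite ltr_wpDl// mulr_ge0// sumr_ge0.
have [h h0 solve] := small_solve sr r0 (divr_gt0 e0 c0).
set S := 1%:M + expint t (Au sys u) *m Au sys u in rE.
(* Initial points and targets within [h / (2 s)] satisfy
   [|a' - S^n a| <= h]. *)
pose s := n%:R * `|S ^+ n| + 1.
have s0 : 0 < s by rewrite ltr_wpDl// mulr_ge0.
have reach a a' : `|a| <= h / (2 * s) -> `|a'| <= h / (2 * s) ->
    orbit_pos sys (x + a) (x + a').
  move=> ad a'd.
  have sh : s * (h / (2 * s)) = h / 2 by field; rewrite gt_eqF.
  have s1 : 1 <= s by rewrite lerDr mulr_ge0.
  have hs0 : 0 <= h / (2 * s) by rewrite divr_ge0 ?mulr_ge0// ltW.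
  have hsh : h / (2 * s) <= h / 2.
    by rewrite -sh -[leLHS]mul1r ler_wpM2r.
  have ah : `|a| <= h by lra.
  have ch : `|a' - S ^+ n *m a| <= h.
    rewrite (le_trans (ler_normB _ _))//.
    have h1 := ler_norm_mulmx (S ^+ n) a.
    have h2 : n%:R * `|S ^+ n| * `|a| <= s * (h / (2 * s)).
      by rewrite ler_pM ?mulr_ge0// lerDl.
    lra.
  have [b bd bE] := solve _ _ ah ch.
  have -> : a' = pw_flow t u x K n a b.
    rewrite rE mul1mx -addrA -bE addrC subrK //.
  apply: orbit_pos_pw_flow => //; first exact: ltW.
  move=> j jn; apply: eO.
  rewrite (le_trans (ler_norm_mulmx _ _))//.
  have Kc : n%:R * `|K j| <= c.
    rewrite /c (bigD1 (Ordinal jn)) //= mulrDr -addrA lerDl.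
    by rewrite addr_ge0// mulr_ge0// sumr_ge0.
  rewrite (le_trans (ler_pM _ _ Kc bd)) ?mulr_ge0//.
  by rewrite mulrCA mulfV ?mulr1// gt_eqF.
apply/nbhs_ballP; exists (h / (2 * s)); first by rewrite /= divr_gt0// mulr_gt0.
have hs0 : 0 <= h / (2 * s) by rewrite divr_ge0 ?mulr_ge0// ltW.
move=> y; rewrite -ball_normE /ball_ /= distrC => yx.
have yE : x + (y - x) = y by rewrite addrC subrK.
have yd := ltW yx.
split.
- by have := reach 0 (y - x); rewrite normr0 addr0 yE; apply.
- by have := reach (y - x) 0; rewrite normr0 addr0 yE; apply.
Qed.

End LocalControllability.

(** * Euclidean norm and distance to the unit sphere of a kernel *)

Section EuclideanNorm.
Context (R : realType) (n : nat).
Implicit Types x y : 'cV[R]_n.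

Lemma enorm_ge0 x : 0 <= enorm x.
Proof. exact: sqrtr_ge0. Qed.

Lemma sqr_enorm x : enorm x ^+ 2 = \sum_i x i 0 ^+ 2.
Proof. by rewrite sqr_sqrtr// sumr_ge0// => i _; rewrite sqr_ge0. Qed.

Lemma mx_norm_le_enorm x : `|x| <= enorm x.
Proof.
apply: mx_norm_leP => [|i j]; first exact: enorm_ge0.
rewrite ord1 -(@ler_pXn2r _ 2) ?nnegrE ?enorm_ge0//.
rewrite sqr_enorm real_normK ?num_real// (bigD1 i)//= lerDl.
by rewrite sumr_ge0// => k _; rewrite sqr_ge0.
Qed.

Lemma enorm_le_mx_norm x : enorm x <= n%:R * `|x|.
Proof.
rewrite -(@ler_pXn2r _ 2) ?nnegrE ?enorm_ge0// ?mulr_ge0//.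
rewrite sqr_enorm exprMn.
apply: (@le_trans _ _ (\sum_(i < n) `|x| ^+ 2)).
  apply: ler_sum => i _; rewrite -[X in X <= _]real_normK ?num_real//.
  by rewrite lerXn2r ?nnegrE// mx_entry_le.
rewrite sumr_const card_ord -[leLHS]mulr_natl ler_wpM2r ?exprn_ge0//.
by rewrite -natrX ler_nat; case: n => // k; rewrite expnS expn1 leq_pmulr.
Qed.

Lemma enormZ c x : enorm (c *: x) = `|c| * enorm x.
Proof.
rewrite /enorm -sqrtr_sqr -sqrtrM ?sqr_ge0// mulr_sumr.
by congr Num.sqrt; apply: eq_bigr => i _; rewrite mxE exprMn.
Qed.

Lemma enorm_eq0 x : enorm x = 0 -> x = 0.
Proof.
move=> x0; apply/eqP; rewrite -normr_eq0 eq_le normr_ge0 andbT -x0.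
exact: mx_norm_le_enorm.
Qed.

(** Cauchy--Schwarz, by expanding the sum of squares of [|y| x - |x| y]. *)
Lemma dot_le_enorm x y : \sum_i x i 0 * y i 0 <= enorm x * enorm y.
Proof.
have [/enorm_eq0 ->|x0] := eqVneq (enorm x) 0.
  rewrite big1 ?mulr_ge0 ?enorm_ge0// => i _; first by rewrite mxE mul0r.
have [/enorm_eq0 ->|y0] := eqVneq (enorm y) 0.
  rewrite big1 ?mulr_ge0 ?enorm_ge0// => i _; first by rewrite mxE mulr0.
have ab0 : 0 < enorm x * enorm y.
  by rewrite mulr_gt0// lt_neqAle enorm_ge0 eq_sym ?x0 ?y0.
set a := enorm x in x0 ab0 *; set b := enorm y in y0 ab0 *.
have : 0 <= \sum_i (b * x i 0 - a * y i 0) ^+ 2.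
  by rewrite sumr_ge0// => i _; rewrite sqr_ge0.
have -> : \sum_i (b * x i 0 - a * y i 0) ^+ 2 =
    b ^+ 2 * \sum_i x i 0 ^+ 2 + a ^+ 2 * \sum_i y i 0 ^+ 2
    - 2 * (a * b) * \sum_i x i 0 * y i 0.
  rewrite !mulr_sumr -big_split -sumrB/=; apply: eq_bigr => i _; ring.
rewrite -!sqr_enorm -/a -/b.
have -> : b ^+ 2 * a ^+ 2 + a ^+ 2 * b ^+ 2 -
    2 * (a * b) * \sum_i x i 0 * y i 0 =
  (2 * (a * b)) * (a * b - \sum_i x i 0 * y i 0) by ring.
by rewrite pmulr_rge0 ?subr_ge0// mulr_gt0.
Qed.

Lemma ler_enormD x y : enorm (x + y) <= enorm x + enorm y.
Proof.
rewrite -(@ler_pXn2r _ 2) ?nnegrE ?addr_ge0 ?enorm_ge0//.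
rewrite sqrrD !sqr_enorm.
have -> : \sum_i (x + y) i 0 ^+ 2 = \sum_i x i 0 ^+ 2 +
    (\sum_i x i 0 * y i 0) *+ 2 + \sum_i y i 0 ^+ 2.
  rewrite -sumrMnl -!big_split/=; apply: eq_bigr => i _.
  by rewrite mxE sqrrD.
by rewrite lerD2r lerD2l lerMn2r dot_le_enorm orbT.
Qed.

Lemma enormN x : enorm (- x) = enorm x.
Proof. by rewrite -scaleN1r enormZ normrN1 mul1r. Qed.

(** Subtracting [N A z] projects [z] into the kernel, since [N] is a generalized
    inverse; renormalizing the projection costs at most the same distance
    again. *)
Lemma edist_kernel_sphere (A N : 'M[R]_n) z :
    A *m N *m A = A -> enorm z = 1 -> enorm (N *m (A *m z)) <= 2^-1 ->
  (edist_to (mxker A `&` @esphere R n) z <= (2 * enorm (N *m (A *m z)))%:E)%E.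
Proof.
move=> ANA z1 d12; set d := enorm _ in d12 *.
pose p := z - N *m (A *m z).
have Ap : A *m p = 0 by rewrite mulmxBr !mulmxA ANA subrr.
have zp : z - p = N *m (A *m z) by rewrite opprB addrC subrK.
have p_ge : 1 - d <= enorm p.
  by rewrite lerBlDr -z1 -[z in enorm z](subrK p) addrC zp ler_enormD.
have p_le : enorm p <= 1 + d.
  by rewrite -z1 (le_trans (ler_enormD _ _))// enormN.
have p0 : 0 < enorm p by lra.
pose s := (enorm p)^-1 *: p.
apply: (@le_trans _ _ (enorm (z - s))%:E).
  apply: ereal_inf_lbound; exists s => //; split.
    by rewrite /mxker /= -scalemxAr Ap scaler0.
  by rewrite /esphere /= enormZ gtr0_norm ?invr_gt0// mulVf// gt_eqF.
rewrite lee_fin -(subrKA p) (le_trans (ler_enormD _ _))// zp -/d.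
have -> : p - s = (1 - (enorm p)^-1) *: p by rewrite scalerBl scale1r.
rewrite enormZ -[X in `|_| * X]ger0_norm ?enorm_ge0// -normrM.
rewrite mulrBl mul1r mulVf ?gt_eqF//.
have : `|enorm p - 1| <= d by rewrite ler_norml; lra.
lra.
Qed.

End EuclideanNorm.

(** * Equilibria near a singular control value *)

Section Asymptotics.
Context (R : realType) (n m : nat) (sys : affine_system R n m).

Lemma cvg_Au (T : Type) (F : set_system T) (u : T -> 'cV[R]_m) (u0 : 'cV[R]_m) :
  Filter F -> u x @[x --> F] --> u0 -> Au sys (u x) @[x --> F] --> Au sys u0.
Proof.
move=> FF uu0; apply: cvgD; first exact: cvg_cst.
apply: cvg_sumr => i; apply: cvg_mx => k l.
under eq_fun do rewrite mxE.
rewrite mxE; apply: cvgM; last exact: cvg_cst.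
apply: (@cvg_comp _ _ _ u (fun v : 'cV[R]_m => v i 0)); first exact: uu0.
exact: coord_continuous.
Qed.

(** The cokernel of the transpose collects all linear forms that vanish on the
    range. *)
Lemma not_mxrange_separated (M : 'M[R]_n) (b : 'cV[R]_n) :
  ~ mxrange M b -> exists2 W : 'M[R]_n, W *m M = 0 & W *m b <> 0.
Proof.
move=> nb; exists (cokermx M^T)^T.
  by rewrite -[M in _ *m M]trmxK -trmx_mul mulmx_coker trmx0.
move=> Wb0; apply: nb.
have : (b^T <= M^T)%MS.
  by rewrite submxE -[b^T *m _]trmxK trmx_mul trmxK Wb0 trmx0.
move=> /submxP[D bD]; exists D^T => //.
by rewrite -[b]trmxK bD trmx_mul trmxK.
Qed.

Context (u0 : 'cV[R]_m)
  (u0_range : ~ mxrange (Au sys u0) (sysC sys *m u0 + sysd sys)).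

Lemma equilibrium_neq u x : equilibrium sys u x -> u <> u0.
Proof.
move=> ux uu0; apply: u0_range; exists (- x) => //.
rewrite mulmxN -uu0; apply/eqP; rewrite eq_sym -subr_eq0 opprK.
by rewrite addrC addrA -[X in X == _]/(rhs sys u x) -ux.
Qed.

Lemma equilibrium_uniq u x y : \rank (Au sys u) = n ->
  equilibrium sys u x -> equilibrium sys u y -> x = y.
Proof.
move=> rk ux uy; have fA : row_full (Au sys u) by apply/eqP.
have uA : Au sys u \in unitmx by rewrite -row_full_unit.
apply: (can_inj (mulKmx uA)); have := ux; rewrite /equilibrium uy /rhs.
by move/addIr/addIr.
Qed.

Section Sequence.
Context (u : nat -> 'cV[R]_m) (x : nat -> 'cV[R]_n) (uu0 : u @ \oo --> u0)
  (ux : forall k, equilibrium sys (u k) (x k)).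

Let b k := sysC sys *m u k + sysd sys.

Let cvg_b : b k @[k --> \oo] --> sysC sys *m u0 + sysd sys.
Proof.
apply: cvgD; last exact: cvg_cst.
by apply: cvg_mulmx; [exact: cvg_cst|exact: uu0].
Qed.

Let eqA k : Au sys (u k) *m x k = - b k.
Proof.
apply/eqP; rewrite -subr_eq0 opprK addrA -[X in X == _]/(rhs sys _ _).
by rewrite -ux.
Qed.

(** Applying a matrix [W] that annihilates [A(u0)] but not the affine part to
    the equilibrium equation bounds [|W (C u_k + d)|], which has a nonzero
    limit, by a null sequence times [|x_k|]. *)
Lemma equilibria_norm_cvgy : enorm (x k) @[k --> \oo] --> +oo.
Proof.
have [W WA Wb] := not_mxrange_separated u0_range.
set c := `|W *m (sysC sys *m u0 + sysd sys)|.
have c0 : 0 < c by rewrite normr_gt0; apply/eqP.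
have cWb : `|W *m b k| @[k --> \oo] --> c.
  by apply: cvg_norm; apply: cvg_mulmx; [exact: cvg_cst|exact: cvg_b].
have cWA : `|W *m Au sys (u k)| @[k --> \oo] --> (0 : R).
  rewrite -[X in _ --> X](@normr0 _ 'M[R]_n) -WA.
  apply: cvg_norm; apply: cvg_mulmx; first exact: cvg_cst.
  exact: cvg_Au uu0.
apply/cvgryPge => M.
have e0 : 0 < c / 2 by rewrite divr_gt0.
pose N := n%:R * (`|M| + 1) + 1.
have N0 : 0 < N by rewrite ltr_wpDl// mulr_ge0// addr_ge0.
have f0 : 0 < c / 4 / N by rewrite !divr_gt0.
move/cvgrPdist_lt: cWb => /(_ _ e0) cWb.
move/cvgrPdist_lt: cWA => /(_ _ f0) cWA.
apply: filterS2 cWb cWA => k h1 h2.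
rewrite sub0r normrN normr_id in h2.
have h3 : c / 2 < `|W *m b k|.
  by have := ler_norm (c - `|W *m b k|); lra.
apply: le_trans (mx_norm_le_enorm _).
rewrite leNgt; apply/negP => xM.
have : `|W *m b k| <= n%:R * `|W *m Au sys (u k)| * `|x k|.
  rewrite -[b k]opprK -eqA mulmxN normrN mulmxA; exact: ler_norm_mulmx.
apply/negP; rewrite -ltNge; apply: lt_trans h3.
apply: (@le_lt_trans _ _ (n%:R * (`|M| + 1) * `|W *m Au sys (u k)|)).
  rewrite mulrAC ler_wpM2r// ler_wpM2l// (le_trans (ltW xM))//.
  by rewrite (le_trans (ler_norm _))// lerDl.
apply: (@le_lt_trans _ _ (N * `|W *m Au sys (u k)|)).
  by rewrite ler_wpM2r// lerDl.
rewrite mulrC -ltr_pdivlMr// (lt_trans h2)// ltr_pM2r ?invr_gt0//; lra.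
Qed.

(** The image [A(u0) z_k] of the normalized equilibria splits into
    [(A(u0) - A(u_k)) z_k] and the affine part divided by [|x_k|]; both tend to
    zero, and the distance to the kernel sphere is controlled by this image. *)
Lemma normalized_equilibria_cvg :
  edist_to (mxker (Au sys u0) `&` @esphere R n)
    ((enorm (x k))^-1 *: x k) @[k --> \oo] --> 0%E.
Proof.
pose A0 := Au sys u0; pose N := pinvmx A0.
have ANA : A0 *m N *m A0 = A0 by rewrite mulmxKpV.
pose z k := (enorm (x k))^-1 *: x k.
have xinf := equilibria_norm_cvgy.
have x1 : \forall k \near \oo, enorm (z k) = 1.
  move/cvgryPgt: xinf => /(_ 0); apply: filterS => k xk.
  by rewrite enormZ gtr0_norm ?invr_gt0// mulVf// gt_eqF.
have xinv : (enorm (x k))^-1 @[k --> \oo] --> (0 : R).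
  apply/gtr0_cvgV0; last exact: xinf.
  by move/cvgryPgt: xinf => /(_ 0).
have Az : A0 *m z k @[k --> \oo] --> (0 : 'cV[R]_n).
  have -> : (fun k => A0 *m z k) =
      (fun k => (A0 - Au sys (u k)) *m z k - (enorm (x k))^-1 *: b k).
    apply/funext => k; rewrite mulmxBl -[_ *: b k]opprK -scalerN -eqA.
    by rewrite scalemxAr opprK subrK.
  rewrite -[X in _ --> X](subr0 0); apply: cvgB; last first.
    rewrite -[X in _ --> X](scale0r (sysC sys *m u0 + sysd sys)).
    exact: cvgZ xinv cvg_b.
  apply: (@cvg0_le _ _ _ (fun k => n%:R * `|A0 - Au sys (u k)|)).
    apply: filterS x1 => k zk1; apply: le_trans (ler_norm_mulmx _ _) _.
    rewrite ler_piMr ?mulr_ge0// -zk1; exact: mx_norm_le_enorm.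
  rewrite -[X in _ --> X](mulr0 n%:R); apply: cvgM; first exact: cvg_cst.
  rewrite -(@normr0 _ 'M[R]_n) -(subrr A0); apply: cvg_norm; apply: cvgB.
    exact: cvg_cst.
  exact: cvg_Au uu0.
have Nz : 2 * enorm (N *m (A0 *m z k)) @[k --> \oo] --> (0 : R).
  apply: (@cvg0_le _ R^o _ (fun k => 2 * (n%:R * `|N *m (A0 *m z k)|))).
    apply: nearW => k; rewrite ger0_norm ?mulr_ge0 ?enorm_ge0//.
    by rewrite ler_pM2l// enorm_le_mx_norm.
  rewrite -[X in _ --> X](mulr0 2); apply: cvgM; first exact: cvg_cst.
  rewrite -[X in _ --> X](mulr0 n%:R); apply: cvgM; first exact: cvg_cst.
  rewrite -(@normr0 _ 'cV[R]_n) -(mulmx0 _ N); apply: cvg_norm.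
  by apply: cvg_mulmx; [exact: cvg_cst|exact: Az].
apply: (@squeeze_cvge _ _ _ _ (cst 0%E) _
  (fun k => (2 * enorm (N *m (A0 *m z k)))%:E)); last 2 first.
- exact: cvg_cst.
- by apply: cvg_EFin Nz => //; apply: nearW.
have h1 : 0 < 1 :> R := ltr01.
move/cvgrPdist_lt: Nz => /(_ _ h1) Nz.
apply: filterS2 x1 Nz => k zk1 Nzk.
rewrite sub0r normrN ger0_norm ?mulr_ge0 ?enorm_ge0// in Nzk.
apply/andP; split.
  apply: le_ereal_inf_tmp => _ [y _ <-]; rewrite lee_fin; exact: enorm_ge0.
apply: edist_kernel_sphere => //; lra.
Qed.

End Sequence.
End Asymptotics.

Theorem theorem5p13 (R : realType) (n m : nat) (sys : affine_system R n m)
    (C : set 'cV[R]_n) (u0 : 'cV[R]_m)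
    (C_pc : pathwise_connected R C)
    (C_E0 : C `<=` equilibria0 sys)
    (u0_closure : closure (Omega_of sys C) u0)
    (u0_eigen : eigenvalue (Au sys u0) 0)
    (u0_range : ~ mxrange (Au sys u0) (sysC sys *m u0 + sysd sys))
    (reg : forall u, Omega_of sys C u -> u <> u0 -> \rank (Au sys u) = n)
    (kalman : forall u x, Omega_of sys C u -> u <> u0 ->
      equilibrium sys u x -> \rank (kalman_mx sys u x) = n) :
  exists D : set 'cV[R]_n,
    [/\ control_set sys D,
        ~ bounded_set D,
        C `<=` interior D &
        forall (u : nat -> 'cV[R]_m) (x : nat -> 'cV[R]_n),
          (forall k, Omega_of sys C (u k)) ->
          u @ \oo --> u0 ->
          (forall k, equilibrium sys (u k) (x k)) ->
          [/\ forall k, C (x k),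
              enorm (x k) @[k --> \oo] --> +oo &
              edist_to (mxker (Au sys u0) `&` @esphere R n)
                ((enorm (x k))^-1 *: x k) @[k --> \oo] --> 0%E]].
Proof.
have neq u : Omega_of sys C u -> u <> u0.
  by move=> [_ [x ux _]]; exact: equilibrium_neq ux.
have loc x : C x -> nbhs x (mutually_reachable sys x).
  move=> Cx; have [u iu ux] := C_E0 x Cx.
  have Ou : Omega_of sys C u by split => //; exists x.
  exact: (locally_controllable iu ux (kalman u x Ou (neq u Ou) ux)).
have [v [Ov _]] := u0_closure setT filterT.
have [_ [x0 _ Cx0]] := Ov.
have reach := path_connected_mutually_reachable C_pc Cx0 loc.
have [w iw wx0] := C_E0 x0 Cx0.
have [D cD MD] : exists2 D, control_set sys D &
    mutually_reachable sys x0 `<=` D.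
  apply: (control_set_of_locally_controllable Cx0 _ reach).
  - by apply: filterS (loc x0 Cx0) => z [].
  - exact: viable_mutually_reachable (interior_subset iw) wx0.
  - exact: approx_mutually_reachable.
have CD : C `<=` interior D.
  move=> x Cx; apply: filterS (loc x Cx) => z xz; apply: MD.
  exact: mutually_reachable_trans (reach x Cx) xz.
have Cu u x : Omega_of sys C u -> equilibrium sys u x -> C x.
  move=> Ou ux; have [_ [y uy Cy]] := Ou.
  by rewrite (equilibrium_uniq (reg u Ou (neq u Ou)) ux uy).
exists D; split => //; last first.
  move=> u x Ou uu0 ux; split.
  - by move=> k; exact: Cu (Ou k) (ux k).
  - exact: (equilibria_norm_cvgy u0_range uu0 ux).
  - exact: (normalized_equilibria_cvg u0_range uu0 ux).
have seq k : exists u, Omega_of sys C u /\ ball u0 k.+1%:R^-1 u.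
  have [u [Ou bu]] := u0_closure _ (nbhsx_ballx u0 k.+1%:R^-1 ltac:(by [])).
  by exists u.
have [u uP] := choice seq.
have seqx k : exists x, equilibrium sys (u k) x.
  by have [[_ [x ux _]] _] := uP k; exists x.
have [x xP] := choice seqx.
have uu0 : u @ \oo --> u0.
  apply/cvgrPdist_lt => e e0; near=> k.
  have [_] := uP k; rewrite -ball_normE /= => /lt_trans; apply.
  near: k; exact: near_infty_natSinv_lt (PosNum e0).
have xoo := equilibria_norm_cvgy u0_range uu0 xP.
move=> [M [Mreal DM]].
have bnd k : enorm (x k) <= n%:R * (`|M| + 1).
  apply: le_trans (enorm_le_mx_norm _) _; rewrite ler_wpM2l//.
  apply: DM; first by rewrite ltr_pwDr// ler_norm.
  apply: interior_subset; apply: CD; exact: Cu (uP k).1 (xP k).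
move/cvgryPgt: xoo => /(_ (n%:R * (`|M| + 1))) [k _ /(_ k (leqnn k))].
by rewrite /= ltNge bnd.
Unshelve. all: by end_near.
Qed.
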